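(* Let $S$ be an undirected graph on $q$ nodes $u_1,\dots,u_q$, possibly with self-loops, and let $x=(x_1,\dots,x_q)\in\mathbb{N}^q$. Let $\mathsf{X}\subset\mathbb{R}^q$ be the edge cone of $S$, and consider the linear program $$\text{(LP)}\qquad \max\ \mathbf{1}^\top y\quad\text{s.t. } y\in\mathsf{X}\ \text{ and }\ y\le x .$$ Then the following hold: 1. Every extremal solution to (LP) is integer valued. 2. An integer solution to (LP) can be obtained in time $O(q^3)$. 3. Suppose that $x_i\ge 3$ for all $i=1,\dots,q$. Then, for any integer solution $y$ to (LP), the complete $S$-partite graph $K_y$ has a cycle cover $H$ with at most $q$ cycles. Moreover, any such subgraph $H$ is a solution to the problem $$\max\ |V(H)|\quad\text{s.t. } H\subseteq K_x \text{ is 2-regular.}$$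
   Context: $\mathbb{N}$ denotes the positive integers and $\mathbb{N}_0$ the nonnegative integers; $\mathbf 1$ is the all-ones vector; $y\le x$ is meant entrywise; $e_1,\dots,e_q$ is the standard basis of $\mathbb{R}^q$. Graphs are finite and undirected. Edge cone: let $f_1,\dots,f_m$ be the edges of $S$ (self-loops included). For $f_j=(u_k,u_\ell)$, with $u_k=u_\ell$ allowed, set $z_j:=\tfrac12(e_k+e_\ell)\in\mathbb{R}^q$. Then $\mathsf{X}:=\{\sum_{j=1}^m c_jz_j \mid c_j\ge 0 \text{ for all } j\}$. A ''solution'' to an optimization problem means an optimal feasible point; an ''integer solution'' is a solution with all entries integers. The set $\mathsf{Y}_x$ of all solutions to (LP) is a polytope; an ''extremal solution'' is a vertex of $\mathsf{Y}_x$. Complete $S$-partite graph: for $x\in\mathbb{N}_0^q$, $K_x$ is the graph with a map $\pi:V(K_x)\to V(S)$ such that $|\pi^{-1}(u_i)|=x_i$ for all $i$, and such that distinct nodes $v,w$ are adjacent in $K_x$ if and only if $(\pi(v),\pi(w))\in E(S)$ (so $\pi^{-1}(u_i)$ induces a complete graph if $u_i$ has a self-loop, and an independent set otherwise). For $y\le x$, $K_y$ is viewed as a subgraph of $K_x$. A subgraph is 2-regular if it is a node-wise disjoint union of cycles (cycles have at least 3 nodes; the empty union is allowed). A cycle cover of a graph $G$ is a 2-regular subgraph $H$ with $V(H)=V(G)$. In item 2, the running time is that of an algorithm whose input is $S$ and $x$, counting elementary arithmetic operations and comparisons on numbers as unit cost. *)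

(* Defs.v *)
From HB Require Import structures.
From mathcomp Require Import all_boot all_order all_algebra.
From mathcomp Require Export reals.

Set Implicit Arguments.
Unset Strict Implicit.
Unset Printing Implicit Defensive.

Import Order.TTheory GRing.Theory Num.Theory.
Local Open Scope ring_scope.

Definition optimal (T : Type) (d : Order.disp_t) (U : porderType d)
    (F : T -> Prop) (f : T -> U) (t : T) : Prop :=
  F t /\ forall t', F t' -> (f t' <= f t)%O.

(* For polytopes, vertices and extreme points coincide. *)
Definition extreme_point (R : realType) (n : nat) (Y : 'rV[R]_n -> Prop)
    (y : 'rV[R]_n) : Prop :=
  Y y /\ forall (a b : 'rV[R]_n) (t : R), Y a -> Y b -> 0 < t < 1 ->
    y = t *: a + (1 - t) *: b -> a = b.

(* A graph on q nodes, possibly with self-loops, is a symmetric relation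
   S : rel 'I_q; symmetry is a hypothesis of the results, not part of the
   definitions. *)

(* Each undirected edge {k, l} is represented once, by the pair (k, l) with
   k <= l; self-loops are the pairs (k, k). *)
Definition edge_pairs (q : nat) (S : rel 'I_q) : {set 'I_q * 'I_q} :=
  [set f : 'I_q * 'I_q | (f.1 <= f.2)%N && S f.1 f.2].

Definition edge_vector (R : realType) (q : nat) (f : 'I_q * 'I_q) : 'rV[R]_q :=
  2^-1 *: (delta_mx 0 f.1 + delta_mx 0 f.2).

Definition edge_cone (R : realType) (q : nat) (S : rel 'I_q)
    (y : 'rV[R]_q) : Prop :=
  exists c : 'I_q * 'I_q -> R,
    (forall f, f \in edge_pairs S -> 0 <= c f) /\
    y = \sum_(f in edge_pairs S) c f *: edge_vector R f.

Definition LP_feasible (R : realType) (q : nat) (S : rel 'I_q)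
    (x : 'I_q -> nat) (y : 'rV[R]_q) : Prop :=
  edge_cone S y /\ forall i, y 0 i <= (x i)%:R.

Definition LP_solution (R : realType) (q : nat) (S : rel 'I_q)
    (x : 'I_q -> nat) : 'rV[R]_q -> Prop :=
  optimal (LP_feasible S x) (fun y => \sum_i y 0 i).

Definition LP_extremal_solution (R : realType) (q : nat) (S : rel 'I_q)
    (x : 'I_q -> nat) : 'rV[R]_q -> Prop :=
  extreme_point (LP_solution S x).

(* Finite simple graphs whose nodes lie in an ambient finite type T. *)
Record sgraph (T : finType) := SGraph {
  nodes : {set T};
  edges : {set {set T}};
  edgesP : [forall e in edges, (e \subset nodes) && (#|e| == 2)] }.

Definition subgraph (T : finType) (H G : sgraph T) : bool :=
  (nodes H \subset nodes G) && (edges H \subset edges G).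

(* G is (a realization of) the complete S-partite graph K_x, with projection
   pi; the size x i of the i-th class may be 0. *)
Definition complete_partite (q : nat) (S : rel 'I_q) (x : 'I_q -> nat)
    (T : finType) (pi : T -> 'I_q) (G : sgraph T) : Prop :=
  (forall i, #|[set v in nodes G | pi v == i]| = x i) /\
  (forall v w, v \in nodes G -> w \in nodes G -> v != w ->
     ([set v; w] \in edges G) = S (pi v) (pi w)).

(* A cycle is listed by its nodes in cyclic order. *)
Definition cycle_nodes (T : finType) (c : seq T) : {set T} := [set v in c].
Definition cycle_edges (T : finType) (c : seq T) : {set {set T}} :=
  [set [set v; next c v] | v in c].

(* H is the node-wise disjoint union of the cycles in cs. *)
Definition disjoint_cycle_union (T : finType) (cs : seq (seq T))
    (H : sgraph T) : Prop :=
  [/\ all (fun c => uniq c && (3 <= size c)%N) cs,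
      pairwise (fun c d : seq T => [disjoint c & d]) cs,
      nodes H = \bigcup_(c <- cs) cycle_nodes c
    & edges H = \bigcup_(c <- cs) cycle_edges c].

Definition two_regular (T : finType) (H : sgraph T) : Prop :=
  exists cs, disjoint_cycle_union cs H.

Definition at_most_cycles (T : finType) (k : nat) (H : sgraph T) : Prop :=
  exists cs, disjoint_cycle_union cs H /\ (size cs <= k)%N.

Definition cycle_cover (T : finType) (G H : sgraph T) : Prop :=
  [/\ subgraph H G, two_regular H & nodes H = nodes G].

Definition induced_rel (T : finType) (A : {set T}) (e : rel T) : {set {set T}} :=
  [set [set p.1; p.2] | p in [set p : T * T |
     [&& p.1 \in A, p.2 \in A, p.1 != p.2 & e p.1 p.2]]].

Lemma induced_relP (T : finType) (A : {set T}) (e : rel T) :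
  [forall a in induced_rel A e, (a \subset A) && (#|a| == 2)].
Proof.
apply/forall_inP => a /imsetP[[v w]]; rewrite inE /= => /and4P[Av Aw vw _] ->.
by rewrite cards2 vw subUset !sub1set Av Aw.
Qed.

(* The predicate complete_partite is not vacuous: K_y can be realized inside
   K_x whenever y <= x. *)
Lemma complete_partite_exists (q : nat) (S : rel 'I_q) (x y : 'I_q -> nat) :
  symmetric S -> (forall i, y i <= x i)%N ->
  exists (T : finType) (pi : T -> 'I_q) (Kx Ky : sgraph T),
    [/\ complete_partite S x pi Kx, complete_partite S y pi Ky
      & subgraph Ky Kx].
Proof.
move=> symS yx; pose N := (\sum_i x i)%N.
pose T : finType := ('I_q * 'I_N)%type.
pose A (z : 'I_q -> nat) := [set v : T | v.2 < z v.1]%N.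
pose K z := SGraph (induced_relP (A z) (fun v w => S v.1 w.1)).
have KP z : (forall i, z i <= x i)%N -> complete_partite S z fst (K z).
  move=> zx; split=> [i | v w Av Aw vw] /=.
    have ziN : (z i <= N)%N.
      by apply: leq_trans (zx i) _; rewrite /N (bigD1 i) //= leq_addr.
    have -> : [set v in A z | v.1 == i]
              = [set (i, widen_ord ziN k) | k in 'I_(z i)].
      apply/setP => -[j k]; rewrite !inE /=; apply/andP/imsetP => /=.
        move=> [kz /eqP ji]; rewrite ji in kz *.
        by exists (Ordinal kz) => //; congr pair; apply: val_inj.
      by move=> [l _ [-> ->]] /=; rewrite eqxx ltn_ord.
    by rewrite card_imset ?card_ord // => k l [kl]; apply: val_inj.
  apply/imsetP/idP => [[[v' w']] | Svw]; last first.
    by exists (v, w) => //; rewrite inE; apply/and4P; split.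
  rewrite inE /= => /and4P[_ _ v'w' Sv'w'] E.
  have := set21 v w; have := set22 v w; rewrite E !inE.
  case/orP=> /eqP Ew; case/orP=> /eqP Ev; rewrite Ew Ev //.
  - by rewrite Ew Ev eqxx in vw.
  - by rewrite symS.
  - by rewrite Ew Ev eqxx in vw.
exists T, fst, (K x), (K y); split; [exact: KP | exact: KP | ].
have AS : A y \subset A x.
  by apply/subsetP => v; rewrite !inE => /leq_trans; apply.
rewrite /subgraph AS /=; apply/imsetS/subsetP => p.
by rewrite !inE => /and4P[+ + -> ->] => /leq_trans -> // /leq_trans ->.
Qed.

(* Unit-cost random-access computation on integers: a structured language
    over finitely many named integer arrays (array 0 .. array k), in which
    every constant, memory access, arithmetic operation, comparison, assignment
    and branching test takes one unit of time. *)

Inductive binop := Add | Sub | Mul | Div | Eqb | Leb.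

Inductive expr :=
  | Const of int
  | Get of nat & expr
  | Bin of binop & expr & expr.

Inductive cmd :=
  | Skip
  | Put of nat & expr & expr
  | Seq of cmd & cmd
  | If of expr & cmd & cmd
  | While of expr & cmd.

(* s a k is the content of cell k of array a. *)
Definition state := nat -> int -> int.

Definition binop_eval (o : binop) (m n : int) : int :=
  match o with
  | Add => m + n
  | Sub => m - n
  | Mul => m * n
  | Div => (m %/ n)%Z
  | Eqb => (m == n)%R%:Z
  | Leb => (m <= n)%R%:Z
  end.

Fixpoint eval (s : state) (e : expr) : int :=
  match e with
  | Const n => n
  | Get a i => s a (eval s i)
  | Bin o e1 e2 => binop_eval o (eval s e1) (eval s e2)
  end.

Fixpoint expr_cost (e : expr) : nat :=
  match e with
  | Const _ => 1
  | Get _ i => (expr_cost i).+1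
  | Bin _ e1 e2 => (expr_cost e1 + expr_cost e2).+1
  end.

Definition update (s : state) (a : nat) (k v : int) : state :=
  fun b l => if (b == a) && (l == k) then v else s b l.

(* exec c s t s' : started in state s, c halts in state s' after t steps. *)
Inductive exec : cmd -> state -> nat -> state -> Prop :=
  | ExecSkip s : exec Skip s 1 s
  | ExecPut s a i e :
      exec (Put a i e) s (expr_cost i + expr_cost e).+1
           (update s a (eval s i) (eval s e))
  | ExecSeq c1 c2 s1 s2 s3 t1 t2 :
      exec c1 s1 t1 s2 -> exec c2 s2 t2 s3 ->
      exec (Seq c1 c2) s1 (t1 + t2) s3
  | ExecIfTrue b c1 c2 s s' t :
      eval s b <> 0 -> exec c1 s t s' ->
      exec (If b c1 c2) s (expr_cost b + t).+1 s'
  | ExecIfFalse b c1 c2 s s' t :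
      eval s b = 0 -> exec c2 s t s' ->
      exec (If b c1 c2) s (expr_cost b + t).+1 s'
  | ExecWhileTrue b c s1 s2 s3 t1 t2 :
      eval s1 b <> 0 -> exec c s1 t1 s2 -> exec (While b c) s2 t2 s3 ->
      exec (While b c) s1 (expr_cost b + t1 + t2).+1 s3
  | ExecWhileFalse b c s :
      eval s b = 0 -> exec (While b c) s (expr_cost b).+1 s.

(* Input: q in cell 0 of array 0, the adjacency matrix of S row by row in
   array 1, x in array 2; all further arrays are initially 0.  Cells of
   arrays 0, 1, 2 outside the input may hold anything. *)
Definition input_state (q : nat) (S : rel 'I_q) (x : 'I_q -> nat)
    (s : state) : Prop :=
  [/\ s 0%N 0 = q%:Z,
      forall i j : 'I_q, s 1%N (i * q + j)%N%:Z = (S i j)%:Z,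
      forall i : 'I_q, s 2%N i%:Z = (x i)%:Z
    & forall a k, (2 < a)%N -> s a k = 0].

Definition output (q : nat) (s : state) : 'I_q -> int := fun i => s 3%N i%:Z.

(* Main.v *)
(* Writing the weights of the edges as a symmetric matrix, the edge cone consists of the
   vectors of row sums of nonnegative symmetric matrices supported on S; symmetry can be
   relaxed to equality of the row and column sums.  Thus (LP) is a maximum flow problem in
   the bipartite double cover of S, with capacities x on both sides.

   Item 1: if y is optimal and i is a node with y_i < x_i, the set P of the rows reachable
   from i in the residual graph satisfies y(P) = x(N(P)), for otherwise y could be
   augmented.  If y_i is not an integer and P is as small as possible, another noninteger
   node k lies in P, and i and k reach each other, so y moves along both e_i - e_k and
   e_k - e_i inside the set of solutions.

   Item 2: the row sums of any maximum flow, symmetric or not, are a solution to (LP); an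
   integral one is found by the push-relabel method with rounds, in O(q^3) steps.

   Item 3: Hall's theorem gives a permutation of the nodes of K_y that maps every node to
   one of an adjacent class.  With the least number of orbits, no class meets two orbits;
   and an orbit contains a class with y_i = x_i >= 3, because optimality forbids an edge
   between two classes with y_i < x_i.  Conversely the node counts of a 2-regular subgraph
   of K_x are feasible for (LP). *)
Require Import Defs.
From mathcomp Require Import all_boot all_order all_algebra.
From mathcomp Require Import fingroup perm boolp zify ring lra.
Import Order.TTheory GRing.Theory Num.Theory.
Local Open Scope ring_scope.
Set Implicit Arguments.
Unset Strict Implicit.
Unset Printing Implicit Defensive.

(** * Edge cone *)

Section Cone.
Variables (R : realType) (q : nat) (S : rel 'I_q).
Hypothesis symS : symmetric S.
Implicit Types (A B : 'I_q -> 'I_q -> R) (y : 'rV[R]_q).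

Definition flow A := (forall k l, 0 <= A k l) /\ (forall k l, ~~ S k l -> A k l = 0).

(** Averaging row and column sums symmetrizes [A] implicitly, so [A] itself need not be
    symmetric. *)
Definition half_sums A : 'rV[R]_q := \row_i (2^-1 * (\sum_l A i l + \sum_k A k i)).

Lemma sum_edge_vectorE A :
  \sum_k \sum_l A k l *: edge_vector R (k, l) = half_sums A.
Proof.
apply/rowP => i; rewrite !mxE summxE.
under eq_bigr do rewrite summxE.
have E k l : (A k l *: edge_vector R (k, l)) 0 i =
    2^-1 * (A k l * (i == k)%:R + A k l * (i == l)%:R).
  by rewrite !mxE /=; ring.
under eq_bigr do under eq_bigr do rewrite E.
under eq_bigr do rewrite -mulr_sumr big_split /= -mulr_suml.
rewrite -mulr_sumr big_split /=; congr (_ * (_ + _)).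
  rewrite (bigD1 i) //= eqxx mulr1 [X in _ + X]big1 ?addr0 // => k /negPf ki.
  by rewrite eq_sym ki mulr0.
rewrite exchange_big /= (bigD1 i) //= eqxx.
under eq_bigr do rewrite mulr1.
rewrite [X in _ + X]big1 ?addr0 // => l /negPf li.
by rewrite eq_sym li big1 // => k _; rewrite mulr0.
Qed.

Lemma half_sums_cone A : flow A -> edge_cone S (half_sums A).
Proof.
(* The two orientations of an edge are merged into one coefficient; a self-loop occurs only once and
   keeps its single entry. *)
move=> [A0 AS]; exists (fun f => if f.1 == f.2 then A f.1 f.1 else A f.1 f.2 + A f.2 f.1).
split=> [f _|]; first by case: ifP => _; rewrite ?addr_ge0.
rewrite -sum_edge_vectorE pair_big /=.
rewrite (bigID (fun f : 'I_q * 'I_q => (f.1 < f.2)%N)) /=.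
rewrite [X in _ + X](bigID (fun f : 'I_q * 'I_q => (f.1 == f.2)%N)) /=.
rewrite [in X in _ + (_ + X)](reindex_inj (h := fun f : 'I_q * 'I_q => (f.2, f.1))) /=; last first.
  by move=> [a b] [c d] [-> ->].
rewrite [LHS]addrCA.
rewrite [RHS](bigID (fun f : 'I_q * 'I_q => f.1 == f.2)) /=; congr (_ + _).
  rewrite [LHS](bigID (fun f : 'I_q * 'I_q => S f.1 f.2)) /= [X in _ + X]big1 ?addr0; last first.
    by move=> [k l] /= /andP[_ /AS ->]; rewrite scale0r.
  apply: eq_big => [[k l]|[k l]] /=; rewrite ?inE /=.
    by case: (eqVneq k l) => [->|]; rewrite ?ltnn ?leqnn /= ?andbT ?andbF.
  by case: (eqVneq k l) => [->|] //=; rewrite ?andbF.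
have E : (fun f : 'I_q * 'I_q => ~~ (f.2 < f.1)%N && (f.2 != f.1)) =1
         (fun f : 'I_q * 'I_q => (f.1 < f.2)%N).
  by move=> [k l] /=; rewrite -leqNgt -(inj_eq val_inj) /= ltn_neqAle andbC eq_sym.
rewrite (eq_bigl _ _ E) -big_split /=.
rewrite [LHS](bigID (fun f : 'I_q * 'I_q => S f.1 f.2)) /= [X in _ + X]big1 ?addr0; last first.
  move=> [k l] /= /andP[_ Skl]; rewrite (AS _ _ Skl) AS 1?symS //.
  by rewrite !scale0r addr0.
apply: eq_big => [[k l]|[k l]] /=; rewrite ?inE /=.
  by rewrite -(inj_eq val_inj) /= ltn_neqAle andbC andbA andbAC [S k l && _]andbC.
move=> /andP[kl _]; rewrite -(inj_eq val_inj) /= (ltn_eqF kl) scalerDl.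
by congr (_ + _ *: _); rewrite /edge_vector /= addrC.
Qed.

(** The weight of an edge is split equally between its two orientations, while a self-loop keeps its
    full weight on the diagonal. *)
Lemma cone_flow y : edge_cone S y ->
  exists A, [/\ flow A, forall k l, A k l = A l k & forall k, \sum_l A k l = y 0 k].
Proof.
move=> [c [c0 ->]].
pose B k l := if (k, l) \in edge_pairs S then c (k, l) else 0.
have B0 k l : 0 <= B k l by rewrite /B; case: ifP => // /c0.
have BS k l : ~~ S k l -> B k l = 0 by rewrite /B inE /= => /negPf ->; rewrite andbF.
exists (fun k l => 2^-1 * (B k l + B l k)); split.
- split=> k l; first by rewrite mulr_ge0 ?addr_ge0 // invr_ge0.
  by move=> Skl; rewrite !BS ?addr0 ?mulr0 // symS.
- by move=> k l; rewrite addrC.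
move=> k; rewrite -mulr_sumr big_split /=.
suff -> : \sum_(f in edge_pairs S) c f *: edge_vector R f = half_sums B by rewrite mxE.
rewrite -sum_edge_vectorE pair_big /= big_mkcond /=; apply: eq_bigr => -[k' l'] _ /=.
by rewrite /B; case: ifP => // _; rewrite scale0r.
Qed.

Lemma flow_cone A y : flow A -> (forall k, \sum_l A k l = y 0 k) ->
  (forall l, \sum_k A k l = y 0 l) -> edge_cone S y.
Proof.
move=> fA rA cA; suff -> : y = half_sums A by exact: half_sums_cone.
by apply/rowP => i; rewrite mxE rA cA; lra.
Qed.

End Cone.

(** * Weak duality, residual directions and integrality of extremal solutions *)

Section Duality.
Variables (R : realType) (q : nat) (S : rel 'I_q) (x : 'I_q -> nat).
Hypothesis symS : symmetric S.
Implicit Types (A B : 'I_q -> 'I_q -> R) (y : 'rV[R]_q) (P : {set 'I_q}).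

Definition nbhd P : {set 'I_q} := [set l | [exists k in P, S k l]].

Lemma sum_flow_nbhd A P : flow S A ->
  \sum_(k in P) \sum_l A k l = \sum_(l in nbhd P) \sum_(k in P) A k l.
Proof.
move=> [_ AS]; rewrite [RHS]exchange_big /=; apply: eq_bigr => k kP.
rewrite (bigID (mem (nbhd P))) /= [X in _ + X]big1 ?addr0 // => l.
rewrite inE negb_exists => /forallP /(_ k); rewrite kP /=; exact: AS.
Qed.

Lemma sum_flow_subr A P (Q : pred 'I_q) : flow S A ->
  \sum_(l | Q l) \sum_(k in P) A k l <= \sum_(l | Q l) \sum_k A k l.
Proof.
move=> [A0 _]; apply: ler_sum => l _.
by rewrite [leRHS](bigID (mem P)) /= lerDl sumr_ge0.
Qed.

(** The easy half of max-flow min-cut in the double cover: rows outside [P] ship at most their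
    capacity, and whatever rows of [P] ship enters columns of [nbhd P]. *)
Lemma flow_cut A P : flow S A ->
  (forall k, \sum_l A k l <= (x k)%:R) -> (forall l, \sum_k A k l <= (x l)%:R) ->
  \sum_k \sum_l A k l <= \sum_(k in ~: P) (x k)%:R + \sum_(l in nbhd P) (x l)%:R.
Proof.
move=> fA rA cA; rewrite (bigID (mem P)) /= addrC lerD //.
  by rewrite (eq_bigl (mem (~: P))) ?ler_sum // => k; rewrite /= inE.
rewrite sum_flow_nbhd //; apply: le_trans (sum_flow_subr _ _ fA) _.
exact: ler_sum.
Qed.

Lemma LP_feasible_flow y : LP_feasible S x y ->
  exists A, [/\ flow S A, forall k l, A k l = A l k, forall k, \sum_l A k l = y 0 k
    & forall l, \sum_k A k l = y 0 l].
Proof.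
move=> [/cone_flow [] // A [fA sA rA] _]; exists A; split=> // l.
by rewrite -rA; apply: eq_bigr => k _; rewrite sA.
Qed.

Lemma weak_duality y P : LP_feasible S x y ->
  \sum_i y 0 i <= \sum_(k in ~: P) (x k)%:R + \sum_(l in nbhd P) (x l)%:R.
Proof.
move=> fy; have [A [fA sA rA cA]] := LP_feasible_flow fy; have [_ yx] := fy.
under eq_bigr do rewrite -rA.
by apply: flow_cut => // k; rewrite ?rA ?cA.
Qed.

Lemma ler_sum_eq (I : finType) (P : pred I) (F G : I -> R) :
  (forall i, P i -> F i <= G i) -> \sum_(i | P i) G i <= \sum_(i | P i) F i ->
  forall i, P i -> F i = G i.
Proof.
move=> FG le i Pi; apply/eqP; rewrite eq_sym -subr_eq0.
have /psumr_eq0P H : forall i, P i -> 0 <= G i - F i.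
  by move=> j Pj; rewrite subr_ge0 FG.
rewrite (H _ i Pi) // sumrB; apply/eqP; rewrite subr_eq0 eq_le le /=; exact: ler_sum.
Qed.

(* [k] can hand over part of its row sum to [k']: one more unit on [A k l], one less
   on [A k' l]. *)
Definition residual A : rel 'I_q :=
  fun k k' => [exists l, S k l && (0 < A k' l)].

(** The feasible directions at a flow [A]: adding a small multiple of [B] gives a flow again. *)
Definition direction A B :=
  (forall k l, A k l = 0 -> 0 <= B k l) /\ (forall k l, ~~ S k l -> B k l = 0).

Lemma directionD A B1 B2 : direction A B1 -> direction A B2 ->
  direction A (fun k l => B1 k l + B2 k l).
Proof.
move=> [B10 B1S] [B20 B2S]; split=> k l H; first by rewrite addr_ge0 ?B10 ?B20.
by rewrite B1S ?B2S ?addr0.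
Qed.


Definition unit_mx k l : 'I_q -> 'I_q -> R := fun i j => ((i == k) && (j == l))%:R.

Lemma row_sum_unit k l i : \sum_j unit_mx k l i j = (i == k)%:R.
Proof.
rewrite (bigD1 l) //= big1 ?addr0 => [|j /negPf jl]; first by rewrite /unit_mx eqxx andbT.
by rewrite /unit_mx jl andbF.
Qed.

Lemma col_sum_unit k l j : \sum_i unit_mx k l i j = (j == l)%:R.
Proof.
rewrite (bigD1 k) //= big1 ?addr0 => [|i /negPf ik]; first by rewrite /unit_mx eqxx.
by rewrite /unit_mx ik.
Qed.

Lemma unit_mx_supp k l : S k l -> forall i j, ~~ S i j -> unit_mx k l i j = 0.
Proof.
move=> Skl i j; rewrite /unit_mx; case: (eqVneq i k) => [->|//].
by case: (eqVneq j l) => [->|//]; rewrite Skl.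
Qed.

Lemma direction_unit A k l : S k l -> direction A (unit_mx k l).
Proof. by move=> Skl; split=> [i j _|]; [exact: ler0n | exact: unit_mx_supp]. Qed.

(** A residual step from [k] to [m] through column [l] adds a unit at [(k, l)] and removes one at
    [(m, l)]: column sums cancel, and row sums telescope along the path. *)
Lemma direction_path A k k' : flow S A -> connect (residual A) k k' ->
  exists B, [/\ direction A B, forall i, \sum_l B i l = (i == k)%:R - (i == k')%:R
    & forall l, \sum_i B i l = 0].
Proof.
move=> [_ AS] /connectP[p + ->]; elim: p k => [|m p IHp] k /=.
  move=> _; exists (fun _ _ => 0).
  by split=> [|i|l]; rewrite ?big1 ?subrr //; split.
move=> /andP[/existsP[l /andP[Skl Aml]] /IHp[B [dB rB cB]]].
exists (fun i j => unit_mx k l i j - unit_mx m l i j + B i j); split.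
- apply: directionD => //; split=> i j H.
    rewrite /unit_mx; case: (eqVneq i m) => [im|_] /=; last by rewrite subr0 ler0n.
    case: (eqVneq j l) => [jl|_] /=; last by rewrite subr0 ler0n.
    by rewrite im jl in H; rewrite H ltxx in Aml.
  rewrite !unit_mx_supp ?subrr //; apply/negPn/negP => /AS Aml0.
  by rewrite Aml0 ltxx in Aml.
- by move=> i; rewrite big_split sumrB /= !row_sum_unit rB; ring.
- by move=> j; rewrite big_split sumrB /= !col_sum_unit cB; ring.
Qed.

Lemma small_step (I : finType) (a b : I -> R) : (forall i, 0 <= a i) ->
  (forall i, a i = 0 -> 0 <= b i) -> exists e, 0 < e /\ forall i, 0 <= a i + e * b i.
Proof.
(* [M * a i] dominates [|b i|] wherever [a i] is positive, so the step [M^-1] works; quotients by 0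
   are 0 by convention and do no harm. *)
move=> a0 ab; pose M := 1 + \sum_i `|b i| / a i.
have T0 i : 0 <= `|b i| / a i by rewrite divr_ge0.
have M0 : 0 < M by rewrite ltr_pwDl ?ltr01 ?sumr_ge0.
exists M^-1; rewrite invr_gt0; split=> // i.
have [ai0|ai] := eqVneq (a i) 0; first by rewrite addr_ge0 // mulr_ge0 ?ab // invr_ge0 ltW.
have {}ai : 0 < a i by rewrite lt_neqAle eq_sym ai a0.
suff : `|b i| <= M * a i.
  move=> H; rewrite -(pmulr_rge0 _ M0) mulrDr mulrA divff ?gt_eqF // mul1r.
  by have := ler_norm (- b i); rewrite normrN; lra.
rewrite -ler_pdivrMr // /M (bigD1 i) //= addrCA lerDl addr_ge0 ?ler01 //.
exact: sumr_ge0.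
Qed.

Lemma LP_perturb A B y : LP_feasible S x y -> flow S A ->
  (forall k, \sum_l A k l = y 0 k) -> (forall l, \sum_k A k l = y 0 l) ->
  direction A B -> (forall i, y 0 i = (x i)%:R -> half_sums B 0 i <= 0) ->
  exists e, 0 < e /\ LP_feasible S x (y + e *: half_sums B).
Proof.
move=> [_ yx] [A0 AS] rA cA [B0 BS] Bx.
(* The entries of [A] and the slacks of [y] are nonnegative quantities treated together, so that one
   step length serves both. *)
have [||e [e0 E]] := @small_step (('I_q * 'I_q) + 'I_q)%type
  (fun u => match u with inl f => A f.1 f.2 | inr i => (x i)%:R - y 0 i end)
  (fun u => match u with inl f => B f.1 f.2 | inr i => - half_sums B 0 i end).
- by move=> [[k l]|i] //=; rewrite subr_ge0.
- move=> [[k l]|i] /=; first exact: B0.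
  by move=> /eqP; rewrite subr_eq0 oppr_ge0 => /eqP/esym/Bx.
exists e; split=> //; split; last first.
  by move=> i; have := E (inr i); rewrite !mxE; lra.
have -> : y + e *: half_sums B = half_sums (fun k l => A k l + e * B k l).
  apply/rowP => i; rewrite !mxE !big_split /= -!mulr_sumr rA cA; lra.
apply: half_sums_cone => //; split=> k l.
  exact: E (inl (k, l)).
by move=> Skl; rewrite AS // BS // mulr0 addr0.
Qed.

Lemma sum_delta i : \sum_(j < q) (j == i)%:R = 1 :> R.
Proof. by rewrite (bigD1 i) //= eqxx big1 ?addr0 // => j /negPf ->. Qed.

Lemma sum_perturbation B (c : R) k l e y :
  (forall j, half_sums B 0 j = c * ((j == k)%:R + (j == l)%:R)) ->
  \sum_j (y + e *: half_sums B) 0 j = \sum_j y 0 j + e * (c * 2).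
Proof.
move=> hB; rewrite (eq_bigr (fun j => y 0 j + e * (c * ((j == k)%:R + (j == l)%:R)))).
  by rewrite big_split -!mulr_sumr big_split /= !sum_delta.
by move=> j _; rewrite 2!mxE hB.
Qed.

Section Optimum.
Variables (A : 'I_q -> 'I_q -> R) (y : 'rV[R]_q).
Hypotheses (yopt : LP_solution S x y) (fA : flow S A).
Hypotheses (rA : forall k, \sum_l A k l = y 0 k) (cA : forall l, \sum_k A k l = y 0 l).

(** Otherwise the residual path from [i] to [k], followed by the edge to [l], would raise [y] at [i]
    and at [l] and increase the objective; [i = l] is allowed. *)
Lemma no_augmentation i k l : connect (residual A) i k -> S k l ->
  y 0 i < (x i)%:R -> (x l)%:R <= y 0 l.
Proof.
move=> ik Skl yi; rewrite leNgt; apply/negP => yl.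
have [B [dB rB cB]] := direction_path fA ik.
have dB' := directionD dB (direction_unit A Skl).
have hB j : half_sums (fun i j => B i j + unit_mx k l i j) 0 j
    = 2^-1 * ((j == i)%:R + (j == l)%:R).
  by rewrite mxE !big_split /= rB cB row_sum_unit col_sum_unit; ring.
have [fy ymax] := yopt.
have [|e [e0 fy']] := LP_perturb fy fA rA cA dB'.
  move=> j yj; rewrite hB; case: (eqVneq j i) => [ji|_]; first by rewrite -ji yj ltxx in yi.
  by case: (eqVneq j l) => [jl|_]; [rewrite -jl yj ltxx in yl | rewrite addr0 mulr0].
have := ymax _ fy'; rewrite (sum_perturbation _ _ hB) leNgt => /negP; apply.
by rewrite ltrDl mulr_gt0 // mulVf ?ltr01 // pnatr_eq0.
Qed.

Definition reach i : {set 'I_q} := [set k | connect (residual A) i k].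

Lemma sum_reach i : y 0 i < (x i)%:R ->
  \sum_(k in reach i) y 0 k = \sum_(l in nbhd (reach i)) (x l)%:R.
Proof.
move=> yi; under eq_bigr do rewrite -rA.
rewrite sum_flow_nbhd //; apply: eq_bigr => l lN.
have -> : (x l)%:R = y 0 l.
  apply/eqP; rewrite eq_le yopt.1.2 andbT; move: lN; rewrite inE => /existsP[k].
  by rewrite inE => /andP[ik /(no_augmentation ik)]; apply.
(* A row with flow into a column of the neighbourhood is reached through that column, so rows
   outside [reach i] send nothing there. *)
rewrite -cA [RHS](bigID (mem (reach i))) /= [X in _ + X]big1 ?addr0 // => k.
move: lN; rewrite !inE => /existsP[m]; rewrite inE => /andP[im Sml] ik.
apply/eqP; rewrite eq_le fA.1 andbT leNgt; apply: contra ik => Akl.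
by apply: connect_trans im (connect1 _); apply/existsP; exists l; rewrite Sml.
Qed.

(** The direction along a residual path shifts row sums from [k] to [i] and keeps column sums, so
    the objective is unchanged and only [i] needs slack. *)
Lemma half_transfer i k : connect (residual A) i k -> y 0 i < (x i)%:R ->
  exists e, 0 < e /\ LP_solution S x (y + e *: \row_j ((j == i)%:R - (j == k)%:R)).
Proof.
move=> ik yi; have [B [dB rB cB]] := direction_path fA ik.
have hB : half_sums B = 2^-1 *: \row_j ((j == i)%:R - (j == k)%:R).
  by apply/rowP => j; rewrite !mxE rB cB addr0.
have [fy ymax] := yopt.
have [|e [e0 fy']] := LP_perturb fy fA rA cA dB.
  move=> j yj; rewrite hB !mxE; case: (eqVneq j i) => [ji|_]; first by rewrite -ji yj ltxx in yi.
  by rewrite sub0r mulrN oppr_le0 mulr_ge0 ?invr_ge0 ?ler0n.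
exists (e / 2); rewrite divr_gt0 ?ltr0n // -scalerA -hB; split=> //; split=> // y' /ymax.
suff -> : \sum_i0 (y + e *: half_sums B) 0 i0 = \sum_i0 y 0 i0 by [].
rewrite (eq_bigr (fun j => y 0 j + e * (2^-1 * ((j == i)%:R - (j == k)%:R)))).
  by rewrite big_split -!mulr_sumr sumrB /= !sum_delta; ring.
by move=> j _; rewrite hB !mxE.
Qed.

End Optimum.

Theorem LP_extremal_integral y : LP_extremal_solution S x y ->
  forall i, y 0 i \is a Num.int.
Proof.
move=> [yopt yext] i0; apply/negPn/negP => yi0.
have [A [fA _ rA cA]] := LP_feasible_flow yopt.1.
have lt_x i : y 0 i \isn't a Num.int -> y 0 i < (x i)%:R.
  by move=> yi; rewrite lt_neqAle yopt.1.2 andbT; apply: contraNneq yi => ->; exact: natr_int.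
pose rc i := reach A i.
case: (@arg_minnP _ i0 (fun i => y 0 i \isn't a Num.int) (fun i => #|rc i|) yi0) => i yi imin.
have ii : i \in rc i by rewrite inE.
have [k /and3P[ki ik yk]] : exists k, [&& k != i, k \in rc i & y 0 k \isn't a Num.int].
  apply/existsP; apply: contraNT (yi); rewrite negb_exists => /forallP H.
  have := sum_reach yopt fA rA cA (lt_x _ yi); rewrite (bigD1 i) //= => /eqP.
  rewrite eq_sym -subr_eq => /eqP <-; rewrite rpredB ?rpred_sum // => [l _|l /andP[il li]].
    exact: natr_int.
  by have := H l; rewrite li il negbK.
have ik' : connect (residual A) i k by move: ik; rewrite inE.
have sub : rc k \subset rc i.
  by apply/subsetP => l; rewrite !inE; apply: connect_trans.
have /eqP E : rc k == rc i by rewrite eqEcard sub imin.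
have ki' : connect (residual A) k i by move: ii; rewrite -E inE.
have [e [e0 ye]] := half_transfer yopt fA rA cA ik' (lt_x _ yi).
have [f [f0 yf]] := half_transfer yopt fA rA cA ki' (lt_x _ yk).
have ef0 : 0 < e + f by rewrite addr_gt0.
(* With this weight the opposite moves of lengths [e] and [f] cancel, so [y] is a proper convex
   combination of two distinct solutions. *)
have := yext _ _ (f / (e + f)) ye yf.
rewrite divr_gt0 // ltr_pdivrMr // mul1r ltrDr e0 => /(_ isT) H.
have /H/rowP/(_ i) : y = (f / (e + f)) *: (y + e *: \row_j ((j == i)%:R - (j == k)%:R)) +
    (1 - f / (e + f)) *: (y + f *: \row_j ((j == k)%:R - (j == i)%:R)).
  by apply/rowP => j; rewrite !mxE; field; rewrite gt_eqF.
rewrite !mxE eqxx [i == k]eq_sym (negPf ki) /=; lra.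
Qed.

Lemma LP_no_slack_edge y i j : LP_solution S x y -> S i j ->
  y 0 i < (x i)%:R -> y 0 j = (x j)%:R.
Proof.
move=> yopt Sij yi; have [A [fA _ rA cA]] := LP_feasible_flow yopt.1.
apply/eqP; rewrite eq_le yopt.1.2; exact: (no_augmentation yopt fA rA cA (connect0 _ i)).
Qed.

End Duality.

(** * Maximum flows *)

Section MaxFlow.
Variables (R : realType) (q : nat) (S : rel 'I_q) (x : 'I_q -> nat).
Hypothesis symS : symmetric S.
Variable A : 'I_q -> 'I_q -> R.
Hypothesis fA : flow S A.
Hypothesis rA : forall k, \sum_l A k l <= (x k)%:R.
Hypothesis cA : forall l, \sum_k A k l <= (x l)%:R.

Let cut (P : {set 'I_q}) : R := \sum_(k in ~: P) (x k)%:R + \sum_(l in nbhd S P) (x l)%:R.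
Let r k := \sum_l A k l.

(** Dropping from [P] its nodes in [nbhd S P] makes it stable. Such a node joins the complement but,
    by symmetry of [S], leaves the neighbourhood, so it is still paid for once. *)
Lemma stable_cut P : exists I : {set 'I_q}, cut I <= cut P /\ forall k l, k \in I -> l \in I -> ~~ S k l.
Proof.
exists (P :\: nbhd S P); split; last first.
  move=> k l; rewrite !inE => /andP[_ kP] /andP[Nl _]; apply: contra Nl => Skl.
  by apply/existsP; exists k; rewrite kP.
have E Q : cut Q = \sum_k ((k \notin Q)%:R + (k \in nbhd S Q)%:R) * (x k)%:R.
  rewrite /cut [in LHS]big_mkcond [X in _ + X]big_mkcond -big_split /=; apply: eq_bigr => k _.
  by rewrite !inE; do 2![case: ifP => _]; rewrite ?(mul0r, mul1r, add0r, addr0, mulrDl).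
rewrite !E; apply: ler_sum => k _; apply: ler_wpM2r; first exact: ler0n.
rewrite -!natrD ler_nat; have [/=|kNI] := boolP (k \in nbhd S (P :\: nbhd S P)).
  rewrite inE => /existsP[i /andP[]]; rewrite inE => /andP[iNP iP] Sik.
  have kNP : k \in nbhd S P by rewrite inE; apply/existsP; exists i; rewrite iP.
  have kP : k \notin P.
    apply: contra iNP => kP; rewrite inE; apply/existsP; exists k.
    by rewrite kP symS.
  by rewrite kNP kP !inE negb_and kP orbT.
by rewrite in_setD negb_and negbK; do 2!case: (k \in _).
Qed.

(* On the stable set [I] of a minimum cut the flow saturates the columns [N] and nothing
   else enters them, so its transpose can replace the rows in [N]; outside [I] and [N]
   the flow already has row and column sums [x]. *)
Lemma max_flow_rows_optimal P : \sum_k r k = cut P -> LP_solution S x (\row_k r k).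
Proof.
move=> rP; have [I [II stI]] := stable_cut P.
have {II}rI : \sum_k r k = cut I.
  by apply/eqP; rewrite eq_le flow_cut //= rP.
have [A0 AS] := fA; pose N := nbhd S I.
have NI k : k \in I -> k \notin N.
  by move=> kI; rewrite inE; apply/existsP => -[i /andP[iI]]; apply/negP; exact: stI.
have AIN k l : k \in I -> l \notin N -> A k l = 0.
  move=> kI lN; apply: AS; apply: contra lN => Skl; rewrite inE; apply/existsP.
  by exists k; rewrite kI.
have le1 : \sum_(k in ~: I) r k <= \sum_(k in ~: I) (x k)%:R by apply: ler_sum => k _; exact: rA.
have le3 l : l \in N -> \sum_(k in I) A k l <= (x l)%:R.
  move=> _; apply: le_trans (cA l); rewrite [leRHS](bigID (mem I)) /= lerDl.
  by rewrite sumr_ge0.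
have le2 : \sum_(k in I) r k <= \sum_(l in N) (x l)%:R.
  by rewrite /r (sum_flow_nbhd I fA); apply: ler_sum.
have E : \sum_k r k = \sum_(k in ~: I) r k + \sum_(k in I) r k.
  by rewrite (bigID (mem I)) /= addrC; congr (_ + _); apply: eq_bigl => k; rewrite inE.
rewrite E /cut -/N in rI.
have rx k : k \notin I -> r k = (x k)%:R.
  move=> kI; apply: (@ler_sum_eq R _ (mem (~: I)) r (fun k => (x k)%:R)) => [i _||]; [exact: rA | | by rewrite /= inE].
  by rewrite /=; lra.
have cx l : l \in N -> \sum_(k in I) A k l = (x l)%:R.
  apply: (@ler_sum_eq R _ (mem N) (fun l => \sum_(k in I) A k l) (fun l => (x l)%:R)) => //=.
  by rewrite -(sum_flow_nbhd I fA); move: rI le1 le2; rewrite /r; lra.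
have AN k l : k \notin I -> l \in N -> A k l = 0.
  move=> kI lN; have := cA l; rewrite (bigID (mem I)) /= cx // gerDl => le0.
  apply/eqP; rewrite eq_le A0 andbT; apply: le_trans le0.
  by rewrite (bigD1 k) //= lerDl sumr_ge0.
pose M k l := if k \in I then A k l else if l \in I then A l k
              else if k \in N then 0 else A k l.
have fM : flow S M.
  split=> k l; rewrite /M; first by case: ifP => _ //; case: ifP => _ //; case: ifP => _ //.
  by move=> Skl; rewrite (AS k l) // (AS l k) 1?symS //; case: ifP => _ //; case: ifP => _ //; case: ifP => _ //.
have rM k : \sum_l M k l = r k.
  have [kI|kI] := boolP (k \in I); first by apply: eq_bigr => l _; rewrite /M kI.
  have [kN|kN] := boolP (k \in N).
    rewrite rx // -cx // [RHS]big_mkcond; apply: eq_bigr => l _.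
    by rewrite /M (negPf kI) kN.
  apply: eq_bigr => l _; rewrite /M (negPf kI) (negPf kN); case: ifP => // lI.
  by rewrite AIN // AS // symS; apply: contra kN => Slk; rewrite inE;
     apply/existsP; exists l; rewrite lI.
have cM l : \sum_k M k l <= r l.
  have [lI|lI] := boolP (l \in I).
    apply: ler_sum => k _; rewrite /M lI; case: ifP => // kI.
    by rewrite AIN ?NI.
  rewrite rx //; apply: le_trans (cA l); apply: ler_sum => k _.
  by rewrite /M (negPf lI); case: ifP => _ //; case: ifP => _ //.
(* Row sums and column sums of [M] have the same total, so the termwise bound is an equality. *)
have {}cM l : \sum_k M k l = r l.
  apply: (@ler_sum_eq R _ predT (fun l => \sum_k M k l) r) => //=.
  by rewrite [leRHS]exchange_big; apply: ler_sum => k _; rewrite rM.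
split=> [|y fy]; last first.
  apply: le_trans (weak_duality symS I fy) _.
  by rewrite -/N -rI -E; apply: ler_sum => k _; rewrite mxE.
split=> [|i]; last by rewrite mxE; exact: rA.
by apply: (flow_cone symS fM) => k; rewrite mxE.
Qed.

End MaxFlow.

(** * The push-relabel method *)

Section PushRelabel.
Variables (q : nat) (S : rel 'I_q) (x : 'I_q -> nat).

(* A preflow in the bipartite double cover of [S]: row [k] can ship [x k] units to the
   columns adjacent to it, and column [l] keeps up to [x l] units, its link to the sink
   being implicit (the sink has height -1).  [rcur] and [ccur] are the current arcs.
   Nodes are processed in rounds: rows at positions [0..q-1], columns at [q..2q-1];
   [flag] tells whether some node was relabelled in the current round. *)
Record net := Net {
  shipped : 'I_q -> int; rheight : 'I_q -> int; rcur : 'I_q -> int;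
  received : 'I_q -> int; cheight : 'I_q -> int; ccur : 'I_q -> int;
  sent : 'I_q -> 'I_q -> int; pos : int; flag : int; bound : int }.

Definition upd (g : 'I_q -> int) k v : 'I_q -> int := fun i => if i == k then v else g i.
Definition upd2 (g : 'I_q -> 'I_q -> int) k l v : 'I_q -> 'I_q -> int :=
  fun i j => if (i == k) && (j == l) then v else g i j.

Definition int_sum (g : 'I_q -> int) : int := \sum_i g i.

Lemma int_sum_upd g k v : int_sum (upd g k v) = int_sum g - g k + v.
Proof.
rewrite /int_sum (bigD1 k) //= [in RHS](bigD1 k) //= /upd eqxx.
rewrite (eq_bigr g) => [|i /negPf -> //]; ring.
Qed.

Lemma row_upd2 A k l v i :
  \sum_j upd2 A k l v i j = \sum_j A i j + (if i == k then v - A k l else 0).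
Proof.
have [->|ik] := eqVneq i k; last by rewrite addr0; apply: eq_bigr => j _; rewrite /upd2 (negPf ik).
rewrite (bigD1 l) //= [in RHS](bigD1 l) //= /upd2 !eqxx.
rewrite (eq_bigr (A k)) => [|j /negPf -> //]; ring.
Qed.

Lemma col_upd2 A k l v j :
  \sum_i upd2 A k l v i j = \sum_i A i j + (if j == l then v - A k l else 0).
Proof.
have [->|jl] := eqVneq j l; last by rewrite addr0; apply: eq_bigr => i _; rewrite /upd2 (negPf jl) andbF.
rewrite (bigD1 k) //= [in RHS](bigD1 k) //= /upd2 !eqxx.
rewrite (eq_bigr (A^~ l)) => [|i /negPf -> //]; ring.
Qed.

(* [bound] dominates the heights of the active nodes; as long as no node is relabelled,
   nodes pushed to lie strictly below it and processed nodes are inactive, so a round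
   without relabelling decreases the maximal active height. *)
Record push_inv (n : net) : Prop := Inv {
  inv_sent0 : forall k l, 0 <= sent n k l;
  inv_sentS : forall k l, ~~ S k l -> sent n k l = 0;
  inv_shipped : forall k, \sum_l sent n k l = shipped n k;
  inv_received : forall l, \sum_k sent n k l = received n l;
  inv_supply : forall k, shipped n k <= (x k)%:Z;
  inv_rheight : forall k, 0 <= rheight n k <= 2 * q%:Z;
  inv_cheight : forall l, 0 <= cheight n l <= 2 * q%:Z + 1;
  inv_rcur : forall k, 0 <= rcur n k <= q%:Z;
  inv_ccur : forall l, 0 <= ccur n l <= q%:Z;
  inv_pos : 0 <= pos n <= 2 * q%:Z;
  inv_flag : 0 <= flag n <= 1;
  inv_bound : -1 <= bound n;
  inv_forward : forall k l, S k l -> rheight n k <= cheight n l + 1;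
  inv_backward : forall k l, 0 < sent n k l -> cheight n l <= rheight n k + 1;
  inv_sink : forall l, received n l < (x l)%:Z -> cheight n l = 0;
  inv_rpassed : forall k l : 'I_q, l%:Z < rcur n k -> S k l -> rheight n k <= cheight n l;
  inv_cpassed : forall k l : 'I_q, k%:Z < ccur n l -> 0 < sent n k l ->
    cheight n l <= rheight n k;
  inv_ractive : forall k : 'I_q, shipped n k < (x k)%:Z -> rheight n k < 2 * q%:Z ->
    rheight n k <= bound n - (if (flag n == 0) && (k%:Z < pos n) then 1 else 0);
  inv_cactive : forall l : 'I_q, (x l)%:Z < received n l ->
    cheight n l <= bound n - (if (flag n == 0) && (q%:Z + l%:Z < pos n) then 1 else 0) }.

(* [D] is at most [4 q^2 + q].  A relabelling resets a current arc (at most [q]) and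
   raises [bound] and [flag], which is paid for by the multiples of [D]; every other
   step advances [pos] or a current arc, or closes a round. *)
Definition potential (n : net) : int :=
  let D := int_sum (rheight n) + int_sum (cheight n) in
  let C := int_sum (rcur n) + int_sum (ccur n) in
  (2 * q%:Z + 1) * (bound n + flag n - 3 * D) - (q%:Z + 1) * D - C - pos n.

Definition progress n m := push_inv m /\ potential m < potential n.

(** Closing a round lowers [bound] or [flag] by one, worth 2q+1 in the potential, against the 2q
    regained by resetting [pos]. *)
Lemma progress_pass n : push_inv n -> pos n = 2 * q%:Z -> 0 <= bound n ->
  progress n {| shipped := shipped n; rheight := rheight n; rcur := rcur n;
    received := received n; cheight := cheight n; ccur := ccur n; sent := sent n;
    pos := 0; flag := 0; bound := if flag n == 0 then bound n - 1 else bound n |}.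
Proof.
case: n => r d rc f p cc A po fl b [] /= A0 AS rA cA rx dh ph rch cch poh flh bh fo ba si rp cp ra ca pq b0.
split; last first.
  rewrite /potential /= pq; have [->|fl0] := eqVneq fl 0; first by nia.
  have -> : fl = 1 by lia.
  nia.
split=> //=; rewrite ?lexx //=.
- by case: ifP; lia.
- move=> k rk dk; move: (ra k rk dk) (ltn_ord k).
  by case: (eqVneq fl 0) => _ /=; [case: ifP|]; lia.
- move=> l fl'; move: (ca l fl') (ltn_ord l).
  by case: (eqVneq fl 0) => _ /=; [case: ifP|]; lia.
Qed.

Lemma progress_skip n : push_inv n -> pos n < 2 * q%:Z ->
  (forall k : 'I_q, k%:Z = pos n -> shipped n k < (x k)%:Z -> 2 * q%:Z <= rheight n k) ->
  (forall l : 'I_q, q%:Z + l%:Z = pos n -> received n l <= (x l)%:Z) ->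
  progress n {| shipped := shipped n; rheight := rheight n; rcur := rcur n;
    received := received n; cheight := cheight n; ccur := ccur n; sent := sent n;
    pos := pos n + 1; flag := flag n; bound := bound n |}.
Proof.
case: n => r d rc f p cc A po fl b [] /= A0 AS rA cA rx dh ph rch cch poh flh bh fo ba si rp cp ra ca pq rowI colI.
split; last by rewrite /potential /= ?int_sum_upd; lia.
split=> //=.
- lia.
- move=> k rk dk; move: (ra k rk dk) (rowI k).
  case: (eqVneq fl 0) => _ //=.
  case: ifP; case: ifP; lia.
- move=> l fl'; move: (ca l fl') (colI l).
  case: (eqVneq fl 0) => _ //=.
  case: ifP; case: ifP; lia.
Qed.

Lemma progress_rcur n k : push_inv n -> rcur n k < q%:Z ->
  (forall l : 'I_q, l%:Z = rcur n k -> S k l -> rheight n k <= cheight n l) ->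
  progress n {| shipped := shipped n; rheight := rheight n; rcur := upd (rcur n) k (rcur n k + 1);
    received := received n; cheight := cheight n; ccur := ccur n; sent := sent n;
    pos := pos n; flag := flag n; bound := bound n |}.
Proof.
case: n => r d rc f p cc A po fl b [] /= A0 AS rA cA rx dh ph rch cch poh flh bh fo ba si rp cp ra ca rcq adm.
split; last by rewrite /potential /= ?int_sum_upd; lia.
split=> //=.
- by move=> i; rewrite /upd; case: eqP => _; [move: (rch k); lia | exact: rch].
- move=> i l; rewrite /upd; case: eqP => [->|_]; last exact: rp.
  move=> lk Skl; have [/(rp k l)|le] := ltP l%:Z (rc k); first exact.
  by apply: adm => //; lia.
Qed.

Lemma progress_ccur n l : push_inv n -> ccur n l < q%:Z ->
  (forall k : 'I_q, k%:Z = ccur n l -> 0 < sent n k l -> cheight n l <= rheight n k) ->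
  progress n {| shipped := shipped n; rheight := rheight n; rcur := rcur n;
    received := received n; cheight := cheight n; ccur := upd (ccur n) l (ccur n l + 1);
    sent := sent n; pos := pos n; flag := flag n; bound := bound n |}.
Proof.
case: n => r d rc f p cc A po fl b [] /= A0 AS rA cA rx dh ph rch cch poh flh bh fo ba si rp cp ra ca rcq adm.
split; last by rewrite /potential /= ?int_sum_upd; lia.
split=> //=.
- by move=> i; rewrite /upd; case: eqP => _; [move: (cch l); lia | exact: cch].
- move=> k i; rewrite /upd; case: eqP => [->|_]; last exact: cp.
  move=> lk Skl; have [/(cp k l)|le] := ltP k%:Z (cc l); first exact.
  by apply: adm => //; lia.
Qed.

(** Once [rcur] has run out, every adjacent column has been passed and none is lower than [k], so
    raising [k] by one respects [inv_forward]. *)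
Lemma progress_rrelabel n (k : 'I_q) : push_inv n -> pos n < 2 * q%:Z -> rcur n k = q%:Z ->
  rheight n k < 2 * q%:Z -> shipped n k < (x k)%:Z ->
  progress n {| shipped := shipped n; rheight := upd (rheight n) k (rheight n k + 1);
    rcur := upd (rcur n) k 0; received := received n; cheight := cheight n;
    ccur := ccur n; sent := sent n; pos := pos n + 1; flag := 1; bound := bound n + 1 |}.
Proof.
case: n => r d rc f p cc A po fl b [] /= A0 AS rA cA rx dh ph rch cch poh flh bh fo ba si rp cp ra ca pq rck dk rk.
have adm l : S k l -> d k <= p l by apply: rp; rewrite rck; have := ltn_ord l; lia.
(* [bound] and [flag] together grow by at most 2, [D] grows by 1 and [C] falls by q; the weights 3
   and q+1 of [D] outweigh this. *)
split; last by rewrite /potential /= !int_sum_upd rck; nia.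
split=> //=.
- by move=> i; rewrite /upd; case: eqP => _; [move: (dh k); lia | exact: dh].
- by move=> i; rewrite /upd; case: eqP => _; [lia | exact: rch].
- lia.
- lia.
- by move=> i l; rewrite /upd; case: eqP => [->|_]; [move/adm; lia | exact: fo].
- by move=> i l; rewrite /upd; case: eqP => [->|_] /ba; lia.
- by move=> i l; rewrite /upd; case: eqP => [->|_]; [lia | exact: rp].
- by move=> i l il /(cp _ _ il); rewrite /upd; case: eqP => [->|_]; lia.
- move=> i ri; rewrite /upd; case: eqP => _ di; [move: (ra k rk dk)|move: (ra i ri di)];
    case: ifP; lia.
- by move=> l /ca; case: ifP; lia.
Qed.

Lemma progress_crelabel n (l : 'I_q) : push_inv n -> pos n < 2 * q%:Z -> ccur n l = q%:Z ->
  (x l)%:Z < received n l ->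
  progress n {| shipped := shipped n; rheight := rheight n; rcur := rcur n;
    received := received n; cheight := upd (cheight n) l (cheight n l + 1);
    ccur := upd (ccur n) l 0; sent := sent n; pos := pos n + 1; flag := 1;
    bound := bound n + 1 |}.
Proof.
case: n => r d rc f p cc A po fl b [] /= A0 AS rA cA rx dh ph rch cch poh flh bh fo ba si rp cp ra ca pq ccl fl0.
have adm k : 0 < A k l -> p l <= d k by apply: cp; rewrite ccl; have := ltn_ord k; lia.
(* Excess has to come from some row [k], whose height is at most 2q; hence the raised column stays
   within 2q+1. *)
have [k Akl] : exists k, 0 < A k l.
  apply/existsP; apply: contraTT fl0; rewrite negb_exists -cA => /forallP H.
  by rewrite -leNgt big1 // => k _; apply: le_anti; rewrite A0 andbT leNgt H.
split; last by rewrite /potential /= !int_sum_upd ccl; nia.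
split=> //=.
- by move=> i; rewrite /upd; case: eqP => _; [move: (ph l) (adm k Akl) (dh k); lia | exact: ph].
- by move=> i; rewrite /upd; case: eqP => _; [lia | exact: cch].
- lia.
- lia.
- by move=> i j; rewrite /upd; case: eqP => [->|_] /fo; lia.
- by move=> i j; rewrite /upd; case: eqP => [->|_]; [move/adm; lia | exact: ba].
- by move=> j; rewrite /upd; case: eqP => [->|_]; [lia | exact: si].
- by move=> i j il /(rp _ _ il); rewrite /upd; case: eqP => [->|_]; lia.
- by move=> i j; rewrite /upd; case: eqP => [->|_]; [lia | exact: cp].
- by move=> i ri /(ra i ri); case: ifP; lia.
- by move=> j; rewrite /upd; case: eqP => [->|_] /ca; case: ifP; lia.
Qed.

(** Arcs from rows to columns have unlimited capacity, so one push exhausts the row. *)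
Lemma progress_rpush n (k l : 'I_q) : push_inv n -> k%:Z = pos n -> S k l ->
  rheight n k = cheight n l + 1 -> shipped n k < (x k)%:Z -> rheight n k < 2 * q%:Z ->
  let e := (x k)%:Z - shipped n k in
  progress n {| shipped := upd (shipped n) k (x k)%:Z; rheight := rheight n; rcur := rcur n;
    received := upd (received n) l (received n l + e); cheight := cheight n; ccur := ccur n;
    sent := upd2 (sent n) k l (sent n k l + e);
    pos := pos n + 1; flag := flag n; bound := bound n |}.
Proof.
case: n => r d rc f p cc A po fl b [] /= A0 AS rA cA rx dh ph rch cch poh flh bh fo ba si rp cp ra ca kpo Skl dp rk dk.
split; last by rewrite /potential /= ?int_sum_upd; lia.
have Akl := A0 k l; have kq := ltn_ord k.
split=> //=.
- by move=> i j; rewrite /upd2; case: ifP => _; [lia | exact: A0].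
- move=> i j Sij; rewrite /upd2; case: ifP => [/andP[/eqP ik /eqP jl]|_]; last exact: AS.
  by rewrite ik jl Skl in Sij.
- by move=> i; rewrite row_upd2 /upd rA; case: eqP => [->|_]; lia.
- by move=> j; rewrite col_upd2 /upd cA; case: eqP => [->|_]; lia.
- by move=> i; rewrite /upd; case: eqP => [->|_].
- lia.
- move=> i j; rewrite /upd2; case: ifP => [/andP[/eqP -> /eqP ->]|_]; [lia | exact: ba].
- by move=> j; rewrite /upd; case: eqP => [->|_] H; apply: si; lia.
- move=> i j ij; rewrite /upd2; case: ifP => [/andP[/eqP -> /eqP ->]|_]; [lia | exact: cp].
- move=> i; rewrite /upd; case: eqP => [->|ik]; first by rewrite ltxx.
  move=> ri /(ra i ri); have : i%:Z <> k%:Z by move=> [/val_inj].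
  case: (eqVneq fl 0) => _ //=; case: ifP; case: ifP; lia.
- move=> j; rewrite /upd; case: eqP => [->|jl] H.
    by move: (ra k rk dk); case: ifP; case: ifP; lia.
  by move: (ca j H); case: ifP; case: ifP; lia.
Qed.

Lemma progress_cpush n (k l : 'I_q) : push_inv n -> q%:Z + l%:Z = pos n -> 0 < sent n k l ->
  cheight n l = rheight n k + 1 -> (x l)%:Z < received n l ->
  received n l - (x l)%:Z <= sent n k l ->
  let e := received n l - (x l)%:Z in
  progress n {| shipped := upd (shipped n) k (shipped n k - e); rheight := rheight n;
    rcur := rcur n; received := upd (received n) l (x l)%:Z; cheight := cheight n;
    ccur := ccur n; sent := upd2 (sent n) k l (sent n k l - e);
    pos := pos n + 1; flag := flag n; bound := bound n |}.
Proof.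
case: n => r d rc f p cc A po fl b [] /= A0 AS rA cA rx dh ph rch cch poh flh bh fo ba si rp cp ra ca lpo Akl pd fl0 le.
split; last by rewrite /potential /= ?int_sum_upd; lia.
have lq := ltn_ord l; have kq := ltn_ord k.
split=> //=.
- by move=> i j; rewrite /upd2; case: ifP => _; [lia | exact: A0].
- move=> i j Sij; rewrite /upd2; case: ifP => [/andP[/eqP ik /eqP jl]|_]; last exact: AS.
  by rewrite ik jl in Sij; rewrite AS // in Akl.
- by move=> i; rewrite row_upd2 /upd rA; case: eqP => [->|_]; lia.
- by move=> j; rewrite col_upd2 /upd cA; case: eqP => [->|_]; lia.
- by move=> i; rewrite /upd; case: eqP => [->|_]; [move: (rx k); lia | exact: rx].
- lia.
- move=> i j; rewrite /upd2; case: ifP => [/andP[/eqP -> /eqP ->]|_]; [lia | exact: ba].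
- by move=> j; rewrite /upd; case: eqP => [->|_]; [rewrite ltxx | exact: si].
- move=> i j; rewrite /upd2; case: ifP => [/andP[/eqP -> /eqP ->] kcc _|_]; [exact: cp kcc Akl | exact: cp].
(* Row [k] was already processed in this round, but it lies one below the active column [l], hence
   strictly below [bound]. *)
- move=> i; rewrite /upd; case: eqP => [->|ik] ri di.
    by move: (ca l fl0); case: ifP; case: ifP; lia.
  by move: (ra i ri di) (ltn_ord i); case: ifP; case: ifP; lia.
- move=> j; rewrite /upd; case: eqP => [->|jl]; first by rewrite ltxx.
  move=> /ca; have : j%:Z <> l%:Z by move=> [/val_inj].
  case: (eqVneq fl 0) => _ //=; case: ifP; case: ifP; lia.
Qed.

(** The push empties the arc but leaves excess, so [pos] stays; an empty arc cannot be pushed back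
    along and may be passed, which advances the current arc. *)
Lemma progress_cpush_all n (k l : 'I_q) : push_inv n -> q%:Z + l%:Z = pos n -> k%:Z = ccur n l ->
  0 < sent n k l -> cheight n l = rheight n k + 1 -> (x l)%:Z < received n l ->
  sent n k l < received n l - (x l)%:Z ->
  progress n {| shipped := upd (shipped n) k (shipped n k - sent n k l);
    rheight := rheight n; rcur := rcur n;
    received := upd (received n) l (received n l - sent n k l);
    cheight := cheight n; ccur := upd (ccur n) l (ccur n l + 1);
    sent := upd2 (sent n) k l 0; pos := pos n; flag := flag n; bound := bound n |}.
Proof.
case: n => r d rc f p cc A po fl b [] /= A0 AS rA cA rx dh ph rch cch poh flh bh fo ba si rp cp ra ca lpo kcc Akl pd fl0 le.
split; last by rewrite /potential /= ?int_sum_upd; lia.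
have lq := ltn_ord l; have kq := ltn_ord k.
split=> //=.
- by move=> i j; rewrite /upd2; case: ifP => _; [lia | exact: A0].
- by move=> i j Sij; rewrite /upd2; case: ifP => // _; exact: AS.
- by move=> i; rewrite row_upd2 /upd rA; case: eqP => [->|_]; lia.
- by move=> j; rewrite col_upd2 /upd cA; case: eqP => [->|_]; lia.
- by move=> i; rewrite /upd; case: eqP => [->|_]; [move: (rx k); lia | exact: rx].
- by move=> i; rewrite /upd; case: eqP => _; [lia | exact: cch].
- by move=> i j; rewrite /upd2; case: ifP => _; [lia | exact: ba].
- by move=> j; rewrite /upd; case: eqP => [->|_]; [lia | exact: si].
- move=> i j; rewrite /upd2 /upd; case: (eqVneq i k) => [->|ik] /=; case: (eqVneq j l) => [->|jl] //; try exact: cp.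
  move=> icc; apply: cp; have : i%:Z <> k%:Z by move=> [/val_inj/eqP]; apply/negP.
  lia.
- move=> i; rewrite /upd; case: eqP => [->|ik] ri di.
    by move: (ca l fl0); case: ifP; case: ifP; lia.
  by move: (ra i ri di); case: ifP; lia.
- move=> j; rewrite /upd; case: eqP => [->|jl] H; last exact: ca.
  by apply: ca; lia.
Qed.

End PushRelabel.

(** * The program *)

Fixpoint straight (c : cmd) : bool :=
  match c with
  | Skip | Put _ _ _ => true
  | Seq c1 c2 | If _ c1 c2 => straight c1 && straight c2
  | While _ _ => false
  end.

(* Junk on loops, where it leaves the state unchanged. *)
Fixpoint run (c : cmd) (s : state) : state :=
  match c with
  | Skip | While _ _ => s
  | Put a i e => update s a (eval s i) (eval s e)
  | Seq c1 c2 => run c2 (run c1 s)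
  | If b c1 c2 => if eval s b == 0 then run c2 s else run c1 s
  end.

(** For loop-free commands an upper bound: a conditional is charged for both branches. *)
Fixpoint cmd_cost (c : cmd) : nat :=
  match c with
  | Skip | While _ _ => 1
  | Put _ i e => (expr_cost i + expr_cost e).+1
  | Seq c1 c2 => cmd_cost c1 + cmd_cost c2
  | If b c1 c2 => (expr_cost b + (cmd_cost c1 + cmd_cost c2)).+1
  end.

Lemma exec_run c s : straight c -> exists2 t, (t <= cmd_cost c)%N & exec c s t (run c s).
Proof.
elim: c s => [|a i e|c1 IH1 c2 IH2|b c1 IH1 c2 IH2|//] s /=.
- by move=> _; exists 1%N => //; apply: ExecSkip.
- by move=> _; exists (expr_cost i + expr_cost e).+1 => //; apply: ExecPut.
- move=> /andP[/(IH1 s)[t1 le1 ex1] /(IH2 (run c1 s))[t2 le2 ex2]].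
  by exists (t1 + t2)%N; [rewrite leq_add | apply: ExecSeq ex1 ex2].
move=> /andP[/(IH1 s)[t1 le1 ex1] /(IH2 s)[t2 le2 ex2]]; case: eqP => eb.
  by exists (expr_cost b + t2).+1; [lia | apply: ExecIfFalse].
by exists (expr_cost b + t1).+1; [lia | apply: ExecIfTrue].
Qed.

(** The decreasing [F] allows at most [F s] iterations, each computed by [run]; the extra one in the
    bound pays for the last test. *)
Lemma exec_while (b : expr) (c : cmd) (I : state -> Prop) (F : state -> nat) :
  straight c ->
  (forall s, I s -> eval s b <> 0 -> I (run c s) /\ (F (run c s) < F s)%N) ->
  forall s, I s -> exists t s', [/\ exec (While b c) s t s', I s', eval s' b = 0
    & (t <= (F s).+1 * (expr_cost b + cmd_cost c).+1)%N].
Proof.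
move=> sc step s; have [m] := ubnP (F s); elim: m s => // m IHm s sm Is.
have [eb|eb] := eqVneq (eval s b) 0.
  exists (expr_cost b).+1, s; split=> //; first exact: ExecWhileFalse.
  by rewrite -[leqLHS]mul1n leq_mul // ltnS leq_addr.
have [Is' lts] := step s Is (elimN eqP eb).
have [|t [s' [ex Is'' eb' le]]] := IHm (run c s) _ Is'; first by lia.
have [t1 le1 ex1] := exec_run s sc.
exists (expr_cost b + t1 + t).+1, s'; split=> //.
  by apply: ExecWhileTrue ex1 ex; apply/eqP.
have : ((F (run c s)).+2 * (expr_cost b + cmd_cost c).+1 <= (F s).+1 * (expr_cost b + cmd_cost c).+1)%N.
  by rewrite leq_mul2r ltnS lts orbT.
by apply: leq_trans; rewrite [leqRHS]mulSn; lia.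
Qed.

Arguments run : simpl never.
Arguments update : simpl never.

Lemma run_seq c1 c2 s : run (Seq c1 c2) s = run c2 (run c1 s).
Proof. by []. Qed.

Lemma run_put a i e s : run (Put a i e) s = update s a (eval s i) (eval s e).
Proof. by []. Qed.

Lemma run_if b c1 c2 s : run (If b c1 c2) s = if eval s b == 0 then run c2 s else run c1 s.
Proof. by []. Qed.

Definition lt_expr e1 e2 := Bin Leb (Bin Add e1 (Const 1)) e2.

Lemma eval_lt s e1 e2 : (eval s (lt_expr e1 e2) == 0) = ~~ (eval s e1 < eval s e2).
Proof. by rewrite /= lezD1; case: (eval s e1 < eval s e2). Qed.

Lemma eval_eq s e1 e2 : (eval s (Bin Eqb e1 e2) == 0) = (eval s e1 != eval s e2).
Proof. by rewrite /=; case: (eval s e1 == eval s e2). Qed.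

(** Nonzero means true, so a product acts as a conjunction. *)
Lemma eval_and s e1 e2 : (eval s (Bin Mul e1 e2) == 0) = (eval s e1 == 0) || (eval s e2 == 0).
Proof. exact: mulf_eq0. Qed.

(* Array 3 holds [shipped] (the output), 4 [sent] row by row, 5 [received], 6 and 7 the
   heights, 8 and 9 the current arcs; 10, 11 and 12 hold [pos], [flag] and [bound].  The
   zero memory is a valid initial state, so there is nothing to initialise. *)
Definition size_e := Get 0 (Const 0).
Definition pos_e := Get 10 (Const 0).
Definition flag_e := Get 11 (Const 0).
Definition bound_e := Get 12 (Const 0).
Definition adj_e k l := Get 1 (Bin Add (Bin Mul k size_e) l).
Definition cap_e k := Get 2 k.
Definition shipped_e k := Get 3 k.
Definition sent_e k l := Get 4 (Bin Add (Bin Mul k size_e) l).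
Definition received_e l := Get 5 l.
Definition rheight_e k := Get 6 k.
Definition cheight_e l := Get 7 l.
Definition rcur_e k := Get 8 k.
Definition ccur_e l := Get 9 l.
Definition incr e := Bin Add e (Const 1).

Definition skip_cmd := Put 10 (Const 0) (incr pos_e).
Definition relabel_cmd := Seq (Put 11 (Const 0) (Const 1))
  (Seq (Put 12 (Const 0) (incr bound_e)) skip_cmd).

(** Expressions are read afresh at every use, so the cells that [k], [l] and [excess] depend on are
    overwritten only after their last use. *)
Definition row_cmd : cmd :=
  let k := pos_e in let l := rcur_e k in
  let excess := Bin Defs.Sub (cap_e k) (shipped_e k) in
  If (Bin Mul (lt_expr (shipped_e k) (cap_e k))
              (lt_expr (rheight_e k) (Bin Add size_e size_e)))
    (If (Bin Eqb l size_e)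
      (Seq (Put 6 k (incr (rheight_e k))) (Seq (Put 8 k (Const 0)) relabel_cmd))
      (If (Bin Mul (adj_e k l) (Bin Eqb (rheight_e k) (incr (cheight_e l))))
        (Seq (Put 4 (Bin Add (Bin Mul k size_e) l) (Bin Add (sent_e k l) excess))
        (Seq (Put 5 l (Bin Add (received_e l) excess))
        (Seq (Put 3 k (cap_e k)) skip_cmd)))
        (Put 8 k (incr l))))
    skip_cmd.

Definition col_cmd : cmd :=
  let l := Bin Defs.Sub pos_e size_e in let k := ccur_e l in
  let excess := Bin Defs.Sub (received_e l) (cap_e l) in
  If (lt_expr (cap_e l) (received_e l))
    (If (Bin Eqb k size_e)
      (Seq (Put 7 l (incr (cheight_e l))) (Seq (Put 9 l (Const 0)) relabel_cmd))
      (If (Bin Mul (lt_expr (Const 0) (sent_e k l))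
                   (Bin Eqb (cheight_e l) (incr (rheight_e k))))
        (If (lt_expr (sent_e k l) excess)
          (Seq (Put 3 k (Bin Defs.Sub (shipped_e k) (sent_e k l)))
          (Seq (Put 5 l (Bin Defs.Sub (received_e l) (sent_e k l)))
          (Seq (Put 4 (Bin Add (Bin Mul k size_e) l) (Const 0))
            (Put 9 l (incr k)))))
          (Seq (Put 4 (Bin Add (Bin Mul k size_e) l) (Bin Defs.Sub (sent_e k l) excess))
          (Seq (Put 3 k (Bin Defs.Sub (shipped_e k) excess))
          (Seq (Put 5 l (cap_e l)) skip_cmd))))
        (Put 9 l (incr k))))
    skip_cmd.

Definition body_cmd : cmd :=
  If (Bin Eqb pos_e (Bin Add size_e size_e))
    (Seq (If (Bin Eqb flag_e (Const 0)) (Put 12 (Const 0) (Bin Defs.Sub bound_e (Const 1))) Skip)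
    (Seq (Put 11 (Const 0) (Const 0)) (Put 10 (Const 0) (Const 0))))
    (If (lt_expr pos_e size_e) row_cmd col_cmd).

Definition loop_test := Bin Leb (Const 0) bound_e.
Definition program := While loop_test body_cmd.

(* Stated with [eqn] so that tests between literal array names compute. *)
Lemma updateE s a k v b l : update s a k v b l = if eqn b a && (l == k) then v else s b l.
Proof. by []. Qed.

Section Program.
Variables (q : nat) (S : rel 'I_q) (x : 'I_q -> nat).

Definition input_preserved (s : state) : Prop :=
  [/\ s 0%N 0 = q%:Z,
      forall k l : 'I_q, s 1%N (k%:Z * q%:Z + l%:Z) = (S k l)%:Z
    & forall k : 'I_q, s 2%N k%:Z = (x k)%:Z].

Definition view (s : state) : net q := {|
  shipped := fun k => s 3%N k%:Z; rheight := fun k => s 6%N k%:Z; rcur := fun k => s 8%N k%:Z;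
  received := fun l => s 5%N l%:Z; cheight := fun l => s 7%N l%:Z; ccur := fun l => s 9%N l%:Z;
  sent := fun k l => s 4%N (k%:Z * q%:Z + l%:Z);
  pos := s 10%N 0; flag := s 11%N 0; bound := s 12%N 0 |}.

Lemma ord_eqZ (i k : 'I_q) : (i%:Z == k%:Z) = (i == k).
Proof. by []. Qed.

Lemma index_eqZ (i j k l : 'I_q) :
  (i%:Z * q%:Z + j%:Z == k%:Z * q%:Z + l%:Z) = (i == k) && (j == l).
Proof.
apply/eqP/andP => [|[/eqP-> /eqP->] //]; rewrite -!PoszM -!PoszD => -[E].
have q0 : (0 < q)%N by apply: leq_ltn_trans (ltn_ord i).
have := congr1 (divn^~ q) E; rewrite !divnMDl // !divn_small // !addn0 => ik.
by move: E; rewrite ik => /addnI jl; split; apply/eqP/val_inj.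
Qed.

Lemma eq_progress n m m' : m = m' -> progress S x n m -> progress S x n m'.
Proof. by move=> ->. Qed.

Ltac eval_tac := rewrite ?run_seq ?run_put /= ?updateE /=.
Ltac view_tac := rewrite /view /=; congr Net;
  try (apply/funext => ?); try (apply/funext => ?); rewrite ?updateE /= ?ord_eqZ ?index_eqZ //.
Ltac input_tac := split=> *; rewrite !updateE //=.

Lemma step_row s (k : 'I_q) : input_preserved s -> push_inv S x (view s) -> s 10%N 0 = k%:Z ->
  input_preserved (run row_cmd s) /\ progress S x (view s) (view (run row_cmd s)).
Proof.
move=> [q_s S_s x_s] Is pk; have kq := ltn_ord k.
(* A row is inactive for lack of supply or because of height 2q; both cases end in the same skip. *)
have skip : (s 3%N k%:Z < (x k)%:Z -> s 6%N k%:Z < q%:Z + q%:Z -> False) ->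
    input_preserved (run skip_cmd s) /\ progress S x (view s) (view (run skip_cmd s)).
  move=> inactive; eval_tac; split; first by input_tac.
  apply: eq_progress (progress_skip Is _ _ _) => [|||l] /=; first by view_tac.
  - rewrite pk; lia.
  - move=> i; rewrite pk => -[/val_inj ->] rk; rewrite leNgt; apply/negP => dk.
    by apply: inactive; lia.
  - rewrite pk; lia.
rewrite /row_cmd run_if eval_and !eval_lt /= pk q_s x_s.
case: ltP => [rk|rk] /=; last by apply: skip => /lt_geF; rewrite rk.
case: ltP => [dk|dk] /=; last by apply: skip => _ /lt_geF; rewrite dk.
have {}dk : s 6%N k%:Z < 2 * q%:Z by lia.
have pq : s 10%N 0 < 2 * q%:Z by lia.
rewrite run_if eval_eq /= pk q_s; case: eqVneq => [rck|rck] /=.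
  eval_tac; rewrite pk; split; first by input_tac.
  apply: eq_progress (@progress_rrelabel _ _ _ _ k Is pq rck dk rk).
  by view_tac; rewrite pk.
have /= := inv_rcur Is k => /andP[rc0 rcq].
have {rck}rcq : s 8%N k%:Z < q%:Z by rewrite lt_neqAle rck.
(* The current arc has not run out, so its value indexes an actual column. *)
have [l lE] : exists l : 'I_q, s 8%N k%:Z = l%:Z.
  case: (s 8%N k%:Z) rc0 rcq => // m _ mq.
  by exists (Ordinal mq).
rewrite run_if eval_and eval_eq /= pk q_s lE S_s.
have [Skl|Skl] := boolP (S k l) => /=; last first.
  eval_tac; rewrite pk; split; first by input_tac.
  apply: eq_progress (@progress_rcur _ _ _ _ k Is rcq _) => [|l'] /=; first by view_tac.
  by rewrite lE => -[/val_inj ->]; rewrite (negPf Skl).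
case: eqVneq => [adm|adm] /=; last first.
  eval_tac; rewrite pk; split; first by input_tac.
  apply: eq_progress (@progress_rcur _ _ _ _ k Is rcq _) => [|l'] /=; first by view_tac.
  rewrite lE => -[/val_inj ->] _; have /= := inv_forward Is Skl; lia.
eval_tac; rewrite ?(pk, q_s, x_s, lE) /= ?updateE /= ?(pk, q_s, x_s, lE); split; first by input_tac.
apply: eq_progress (@progress_rpush _ _ _ _ k l Is (esym pk) Skl adm rk dk).
by view_tac; rewrite pk.
Qed.

Lemma step_col s (l : 'I_q) : input_preserved s -> push_inv S x (view s) ->
  s 10%N 0 = q%:Z + l%:Z ->
  input_preserved (run col_cmd s) /\ progress S x (view s) (view (run col_cmd s)).
Proof.
move=> [q_s S_s x_s] Is pl; have lq := ltn_ord l.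
have pq : s 10%N 0 < 2 * q%:Z by lia.
have pl' : s 10%N 0 - q%:Z = l%:Z by lia.
have nextE : s 10%N 0 + 1 = q%:Z + l%:Z + 1 by rewrite pl.
rewrite /col_cmd run_if eval_lt /= q_s pl' x_s.
case: ltP => [fl|fl] /=; last first.
  eval_tac; split; first by input_tac.
  apply: eq_progress (progress_skip Is pq _ _) => [|k|i] /=; first by view_tac.
    by rewrite pl => kE; have := ltn_ord k; lia.
  by rewrite pl => /addrI [/val_inj ->].
rewrite run_if eval_eq /= q_s pl'; case: eqVneq => [ccl|ccl] /=.
  eval_tac; rewrite ?updateE /= q_s pl'; split; first by input_tac.
  by apply: eq_progress (@progress_crelabel _ _ _ _ l Is pq ccl fl); view_tac.
have /= := inv_ccur Is l => /andP[cc0 ccq].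
have {ccl}ccq : s 9%N l%:Z < q%:Z by rewrite lt_neqAle ccl.
have [k kE] : exists k : 'I_q, s 9%N l%:Z = k%:Z.
  case: (s 9%N l%:Z) cc0 ccq => // m _ mq.
  by exists (Ordinal mq).
rewrite run_if eval_and eval_lt eval_eq /= q_s pl' kE.
have next_k : (0 < sent (view s) k l -> cheight (view s) l <= rheight (view s) k) ->
    input_preserved (run (Put 9 (Bin Defs.Sub pos_e size_e) (incr (ccur_e (Bin Defs.Sub pos_e size_e)))) s) /\
    progress S x (view s) (view (run (Put 9 (Bin Defs.Sub pos_e size_e) (incr (ccur_e (Bin Defs.Sub pos_e size_e)))) s)).
  move=> H; eval_tac; rewrite q_s pl'; split; first by input_tac.
  apply: eq_progress (@progress_ccur _ _ _ _ l Is ccq _) => [|k'] /=; first by view_tac.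
  by rewrite kE => -[/val_inj ->].
case: ltP => [Akl|Akl] /=; last by apply: next_k => /lt_geF; rewrite /= Akl.
case: eqVneq => [adm|adm] /=; last by apply: next_k => /= _; have /= := inv_backward Is Akl; lia.
rewrite run_if eval_lt /= q_s pl' kE x_s; case: ltP => [lt|le] /=.
  eval_tac; rewrite ?(q_s, pl', kE) /= ?updateE /= ?(q_s, pl', kE) /= ?updateE /=; split; first by input_tac.
  apply: eq_progress (@progress_cpush_all _ _ _ _ k l Is (esym pl) (esym kE) Akl adm fl lt).
  by view_tac; rewrite ?kE.
eval_tac; rewrite ?(q_s, pl', x_s, kE) /= ?updateE /= ?(q_s, pl', x_s, kE); split; first by input_tac.
apply: eq_progress (@progress_cpush _ _ _ _ k l Is (esym pl) Akl adm fl le).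
by view_tac.
Qed.

Lemma step_body s : input_preserved s -> push_inv S x (view s) -> 0 <= s 12%N 0 ->
  input_preserved (run body_cmd s) /\ progress S x (view s) (view (run body_cmd s)).
Proof.
move=> [q_s S_s x_s] Is b0; have /= := inv_pos Is => /andP[p0 p2].
rewrite /body_cmd run_if eval_eq /= q_s; case: eqVneq => [pq|pq] /=.
  rewrite !run_seq run_if eval_eq /=; case: eqVneq => [f0|f0] /=.
    eval_tac; split; first by input_tac.
    apply: eq_progress (progress_pass Is _ b0); last by rewrite /= pq; lia.
    by view_tac; rewrite f0.
  eval_tac; split; first by input_tac.
  apply: eq_progress (progress_pass Is _ b0); last by rewrite /= pq; lia.
  by view_tac; rewrite (negPf f0).
have {pq p2}pq : s 10%N 0 < q%:Z + q%:Z by rewrite lt_neqAle pq; lia.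
rewrite run_if eval_lt /= q_s; case: ltP => [lt|le] /=.
  have [k kE] : exists k : 'I_q, s 10%N 0 = k%:Z.
    by case: (s 10%N 0) p0 lt => // m _ mq; exists (Ordinal mq).
  exact: step_row kE.
have [l lE] : exists l : 'I_q, s 10%N 0 - q%:Z = l%:Z.
  have : 0 <= s 10%N 0 - q%:Z < q%:Z by lia.
  by case: (s 10%N 0 - q%:Z) => // m mq; exists (Ordinal mq).
by apply: (@step_col _ l) => //; lia.
Qed.

End Program.

(** * The final cut, the number of steps and the correctness of the program *)

Section Termination.
Variables (q : nat) (S : rel 'I_q) (x : 'I_q -> nat).

(* The [2q - 1] nodes other than [k0] cannot occupy all [2q] heights below it. *)
Lemma height_gap n k0 : push_inv S x n -> rheight n k0 = 2 * q%:Z ->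
  exists g : int, [/\ 0 <= g, g < 2 * q%:Z, forall k, rheight n k <> g & forall l, cheight n l <> g].
Proof.
move=> In dk0; pose h (u : 'I_q + 'I_q) := match u with inl k => rheight n k | inr l => cheight n l end.
case: (pickP (fun g : 'I_(q + q) => [forall u, h u != g%:Z])) => [g /forallP gP|noG].
  exists g%:Z; have := ltn_ord g; split; try lia.
    by move=> k; apply/eqP/(gP (inl k)).
  by move=> l; apply/eqP/(gP (inr l)).
have ex (g : 'I_(q + q)) : exists u, h u == g%:Z.
  by apply/existsP; move: (noG g) => /negbT; rewrite negb_forall => /existsP[u]; rewrite negbK => ?; apply/existsP; exists u.
pose w g := xchoose (ex g); have wP g : h (w g) = g%:Z := eqP (xchooseP (ex g)).
have w_inj : injective w by move=> g g' E; apply: val_inj; have := wP g; rewrite E wP => -[].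
have : (#|[set w g | g : 'I_(q + q)]| <= #|[set~ inl k0 : 'I_q + 'I_q]|)%N.
  apply: subset_leq_card; apply/subsetP => u /imsetP[g _ ->]; rewrite !inE.
  apply/eqP => E; have := wP g; rewrite E /= dk0; have := ltn_ord g; lia.
rewrite card_imset // cardsC1 card_sum !card_ord; have := ltn_ord k0; lia.
Qed.

(** A negative [bound] leaves no active node. Heights drop by at most one along residual arcs, so
    none of these crosses the unoccupied height [g], and the rows above [g] yield a minimum cut. *)
Lemma final_cut n : push_inv S x n -> bound n < 0 ->
  (forall l, received n l <= (x l)%:Z) /\
  exists P : {set 'I_q}, [/\ forall k, k \notin P -> shipped n k = (x k)%:Z,
    forall l, l \in nbhd S P -> received n l = (x l)%:Z
    & forall k l, k \notin P -> l \in nbhd S P -> sent n k l = 0].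
Proof.
move=> In b0.
have rec l : received n l <= (x l)%:Z.
  rewrite leNgt; apply/negP => /(inv_cactive In); have := inv_cheight In l.
  by case: ifP; lia.
have top k : shipped n k < (x k)%:Z -> rheight n k = 2 * q%:Z.
  move=> sk; have := inv_rheight In k; have := inv_ractive In sk; case: ifP; lia.
split=> //; case: (pickP (fun k => shipped n k < (x k)%:Z)) => [k0 sk0|full]; last first.
  exists set0; split=> [k _|l|k l _]; rewrite ?inE; first by apply/eqP; rewrite eq_le (inv_supply In) leNgt full.
    by move=> /existsP[i]; rewrite inE.
  by move=> /existsP[i]; rewrite inE.
have [g [g0 gq gr gc]] := height_gap In (top _ sk0).
have NP l : l \in nbhd S [set k | g < rheight n k] -> g < cheight n l.
  rewrite inE => /existsP[k]; rewrite inE => /andP[gk /(inv_forward In)].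
  by have := gc l; lia.
exists [set k | g < rheight n k]; split.
- move=> k; rewrite inE -leNgt => le; apply/eqP; rewrite eq_le (inv_supply In) leNgt /=.
  by apply/negP => /top; lia.
- move=> l /NP gl; apply/eqP; rewrite eq_le rec leNgt; apply/negP => /(inv_sink In); lia.
move=> k l; rewrite inE -leNgt => le /NP gl; apply/eqP; rewrite eq_le (inv_sent0 In) andbT leNgt.
by apply/negP => /(inv_backward In); have := gr k; lia.
Qed.

Lemma push_inv_init : push_inv S x {| shipped := fun=> 0; rheight := fun=> 0; rcur := fun=> 0;
  received := fun=> 0; cheight := fun=> 0; ccur := fun=> 0; sent := fun _ _ => 0;
  pos := 0; flag := 0; bound := 0 |}.
Proof.
split=> //= *; rewrite ?big1 //; try lia.
Qed.

Lemma int_sum_le (g : 'I_q -> int) c : (forall k, g k <= c) -> int_sum g <= q%:Z * c.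
Proof.
move=> gc; apply: le_trans (ler_sum _ (fun k _ => gc k)) _.
by rewrite sumr_const card_ord -mulr_natl natz.
Qed.

(** At the extreme values of its terms the potential sinks at most 28q^3+25q^2+8q+1 below zero;
    100q^3 is a generous round bound. *)
Lemma potential_ge n : (0 < q)%N -> push_inv S x n -> - (100 * q ^ 3)%N%:Z <= potential n.
Proof.
move=> q0 In; rewrite /potential.
have /int_sum_le D1 k : rheight n k <= 2 * q%:Z by have := inv_rheight In k; lia.
have /int_sum_le D2 k : cheight n k <= 2 * q%:Z + 1 by have := inv_cheight In k; lia.
have /int_sum_le C1 k : rcur n k <= q%:Z by have := inv_rcur In k; lia.
have /int_sum_le C2 k : ccur n k <= q%:Z by have := inv_ccur In k; lia.
have := inv_flag In; have := inv_bound In; have := inv_pos In.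
move: (pos n) (flag n) (bound n) => po f b /andP[_ pq] b0 /andP[f0 _].
set D := int_sum _ + int_sum (cheight n); set C := int_sum _ + int_sum _.
have D_le : D <= q%:Z * (4 * q%:Z + 1) by rewrite /D; nia.
have C_le : C <= 2 * q%:Z ^+ 2 by rewrite /C; nia.
move: D C D_le C_le => D C D_le C_le {D1 D2 C1 C2}.
have -> : (100 * q ^ 3)%N%:Z = 100 * (q%:Z * q%:Z * q%:Z).
  by rewrite !expnS expn0 muln1 !PoszM -!mulrA.
have Q0 : 0 <= q%:Z - 1 by lia.
move: (q%:Z) pq D_le C_le Q0 => Q pq D_le C_le Q0.
have h1 : 0 <= (2 * Q + 1) * (b + f + 1) by apply: mulr_ge0; lia.
(* The factor 7Q+4 is the total weight 3(2Q+1)+(Q+1) of [D] in the potential. *)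
have h2 : 0 <= (7 * Q + 4) * (Q * (4 * Q + 1) - D) by apply: mulr_ge0; lia.
have h3 : 0 <= Q * (Q - 1) by apply: mulr_ge0; lia.
have h4 : 0 <= Q * Q * (Q - 1) by rewrite mulr_ge0 ?mulr_ge0 //; lia.
rewrite expr2 in C_le; nia.
Qed.

Lemma program_correct (R : realType) s : (0 < q)%N -> symmetric S -> input_state S x s ->
  exists t s', [/\ exec program s t s',
    (t <= (expr_cost loop_test + cmd_cost body_cmd).+1 * 101 * q ^ 3)%N
    & LP_solution S x (\row_i (output s' i)%:~R : 'rV[R]_q)].
Proof.
move=> q0 symS [q_s S_s x_s s0].
pose I s1 := input_preserved S x s1 /\ push_inv S x (view q s1).
(* The potential starts at 0, so shifting it by its lower bound gives a ranking function with
   initial value 100q^3. *)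
pose F s1 := absz (potential (view q s1) + (100 * q ^ 3)%N%:Z).
have view_s : view q s = {| shipped := fun=> 0; rheight := fun=> 0; rcur := fun=> 0;
    received := fun=> 0; cheight := fun=> 0; ccur := fun=> 0; sent := fun _ _ => 0;
    pos := 0; flag := 0; bound := 0 |}.
  by rewrite /view !s0 //; congr Net; do 2?[apply/funext => ?]; rewrite s0.
have Is : I s.
  split; last by rewrite view_s; exact: push_inv_init.
  by split=> // k l; rewrite -PoszM -PoszD S_s.
have F_s : F s = (100 * q ^ 3)%N.
  by rewrite /F view_s /potential /= /int_sum !big1 // !(mulr0, subr0, addr0, add0r).
have step s1 : I s1 -> eval s1 loop_test <> 0 -> I (run body_cmd s1) /\ (F (run body_cmd s1) < F s1)%N.
  move=> [in1 I1] b1; have [] := step_body in1 I1.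
    by move: b1 => /=; case: (0 <= _).
  move=> in2 [I2 lt]; split=> //; rewrite /F.
  have := potential_ge q0 I1; have := potential_ge q0 I2.
  move: (potential _) (potential _) lt (_ * _)%N => u v lt c; lia.
have [//|t [s' [ex [in' I'] b' le]]] := exec_while (b := loop_test) (c := body_cmd) _ step Is.
exists t, s'; split=> //.
  apply: leq_trans le _; rewrite F_s mulnC -mulnA leq_mul2l; apply/orP; right.
  have : (0 < q ^ 3)%N by rewrite expn_gt0 q0.
  lia.
have b'0 : bound (view q s') < 0 by rewrite ltNge; apply/negP => /= b0; move: b'; rewrite /= b0.
have [rec [P [Pc Nc Pz]]] := final_cut I' b'0.
pose A k l : R := (sent (view q s') k l)%:~R.
have fA : flow S A.
  split=> k l; first by rewrite ler0z (inv_sent0 I').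
  by move=> /(inv_sentS I'); rewrite /A => ->.
have rA k : \sum_l A k l = (shipped (view q s') k)%:~R.
  by rewrite -(inv_shipped I') rmorph_sum.
have cA l : \sum_k A k l = (received (view q s') l)%:~R.
  by rewrite -(inv_received I') rmorph_sum.
have natz_le m k : m <= Posz k -> m%:~R <= k%:R :> R by rewrite -(ler_int R) -pmulrn.
have -> : \row_i (output s' i)%:~R = \row_i \sum_l A i l by apply/rowP => i; rewrite !mxE rA.
apply: (@max_flow_rows_optimal R q S x symS A fA _ _ P) => [k|l|].
- by rewrite rA natz_le // (inv_supply I').
- by rewrite cA natz_le.
(* The flow attains the cut of [P]: rows outside [P] ship all they have, and the columns of
   [nbhd S P] are filled by rows of [P] alone. *)
rewrite (bigID (mem P)) /= addrC; congr (_ + _).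
  apply: eq_big => [k|k kP]; first by rewrite inE.
  by rewrite rA Pc // -pmulrn.
rewrite (sum_flow_nbhd P fA); apply: eq_bigr => l lN.
transitivity (\sum_k A k l); last by rewrite cA Nc // -pmulrn.
rewrite [RHS](bigID (mem P)) /= [X in _ + X]big1 ?addr0 // => k kP.
by rewrite /A Pz.
Qed.

End Termination.

Local Open Scope nat_scope.

(** * Cycle covers *)

(* [f0] only provides values outside [A]. *)
Lemma hall (T T' : finType) (f0 : T -> T') (e : T -> {set T'}) (A : {set T}) :
  (forall B : {set T}, B \subset A -> #|B| <= #|\bigcup_(b in B) e b|) ->
  exists f, {in A &, injective f} /\ {in A, forall a, f a \in e a}.
Proof.
have [m] := ubnP #|A|; elim: m A e => // m IHm A e leA hallA.
have [->|/set0Pn[a aA]] := eqVneq A set0.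
  by exists f0; split=> u; rewrite inE.
(* A matching of [B] into [E] and one of the rest outside [E] have disjoint images and can be
   combined. *)
have glue (B : {set T}) : B \subset A -> #|B| < #|A| ->
    #|A :\: B| < #|A| ->
    forall E : {set T'}, (exists f, {in B &, injective f} /\ {in B, forall b, f b \in e b :&: E}) ->
    (forall C : {set T}, C \subset A :\: B -> #|C| <= #|(\bigcup_(c in C) e c) :\: E|) ->
  exists f, {in A &, injective f} /\ {in A, forall a, f a \in e a}.
  move=> BA ltB ltAB E [f [f_inj fe]] hallAB.
  have [|C CAB|g [g_inj ge]] := IHm (A :\: B) (fun c => e c :\: E); first by lia.
    apply: leq_trans (hallAB C CAB) _; apply: subset_leq_card; apply/subsetP => u.
    rewrite inE => /andP[uE /bigcupP[c cC ue]]; apply/bigcupP; exists c => //.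
    by rewrite inE uE.
  exists (fun u => if u \in B then f u else g u); split=> [u v uA vA|u uA].
    case: ifPn => uB; case: ifPn => vB; first exact: f_inj.
    - move=> fg; have := fe _ uB; rewrite fg !inE => /andP[_ gE].
      by have := ge v; rewrite !inE vB vA => /(_ isT); rewrite gE.
    - move=> fg; have := fe _ vB; rewrite -fg !inE => /andP[_ gE].
      by have := ge u; rewrite !inE uB uA => /(_ isT); rewrite gE.
    by apply: g_inj; rewrite inE ?uB ?vB.
  case: ifPn => uB; first by have := fe u uB; rewrite inE => /andP[].
  by have := ge u; rewrite !inE uB uA => /(_ isT) /andP[].
(* Either some nonempty proper subset is tight and the problem splits at its neighbourhood, or all
   of them have a neighbour to spare. *)
case: (pickP (fun B : {set T} => [&& B \subset A, 0 < #|B| < #|A| &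
    #|\bigcup_(b in B) e b| <= #|B|])) => [B /and3P[BA /andP[B0 ltB] tight]|loose].
  have cA := cardsID B A; rewrite (setIidPr BA) in cA.
  apply: (glue B BA ltB _ (\bigcup_(b in B) e b)); first by lia.
    have [|C CB|f [f_inj fe]] := IHm B e; first by lia.
      by apply: hallA; apply: subset_trans BA.
    exists f; split=> // b bB; rewrite inE fe //=; apply/bigcupP; exists b => //; exact: fe.
  move=> C; rewrite subsetD => /andP[CA CB].
  (* Hall's condition for the union, less the at most [#|B|] neighbours of the tight set, gives the
     condition for [C]. *)
  have := hallA (C :|: B); rewrite subUset CA BA => /(_ isT).
  rewrite bigcup_setU cardsU (disjoint_setI0 CB) cards0 subn0.
  move: (\bigcup_(i in C) e i) (\bigcup_(i in B) e i) tight => X Y tight.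
  by rewrite cardsU -(cardsID Y X); lia.
(* Without tight subsets any pair [a], [b] may be matched: losing [b] costs each remaining set at
   most its spare neighbour. *)
have [b be] : exists b, b \in e a.
  apply/set0Pn; rewrite -card_gt0; have := hallA [set a]; rewrite sub1set aA big_set1 cards1.
  exact.
have cA := cardsD1 a A; rewrite aA in cA.
have aA' : [set a] \subset A by rewrite sub1set.
(* [glue] requires the singleton of [a] to be a proper subset, so a one-element [A] is treated
   apart. *)
have [A1|A1] := leqP #|A| 1.
  exists (fun=> b); split=> [u v uA vA _|u uA].
    have /subset_leqif_cards/geq_leqif := aA'; rewrite cards1 A1 => /esym/eqP E.
    by move: uA vA; rewrite -E !inE => /eqP -> /eqP ->.
  have /subset_leqif_cards/geq_leqif := aA'; rewrite cards1 A1 => /esym/eqP E.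
  by move: uA; rewrite -E inE => /eqP ->.
apply: (glue [set a] aA' _ _ [set b]); rewrite ?cards1 //; first by lia.
  exists (fun=> b); split=> [u v|u]; rewrite !inE; first by move=> /eqP -> /eqP ->.
  by move=> /eqP ->; rewrite be eqxx.
move=> C CA; have [->|/set0Pn[c cC]] := eqVneq C set0; first by rewrite cards0.
have := loose C; have /subset_leq_card := CA; have := cardsD1 b (\bigcup_(i in C) e i).
rewrite (subset_trans CA (subsetDl _ _)) /=.
have : 0 < #|C| by rewrite card_gt0; apply/set0Pn; exists c.
case: (b \in _) => /=; lia.
Qed.

(** * Permutations of the nodes along edges of [S] *)

Section Cover.
Variables (R : realType) (q : nat) (S : rel 'I_q) (y : 'I_q -> nat).
Variables (T : finType) (pi : T -> 'I_q) (N : {set T}).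
Hypothesis symS : symmetric S.
Hypothesis card_class : forall i, #|[set v in N | pi v == i]| = y i.

Lemma card_classes (J : {set 'I_q}) : #|[set v in N | pi v \in J]| = \sum_(k in J) y k.
Proof.
rewrite -sum1_card (partition_big pi (mem J)) /=; last by move=> v; rewrite inE => /andP[].
apply: eq_bigr => k kJ; rewrite -card_class -sum1_card; apply: eq_bigl => v.
by rewrite !inE; case: eqP => [->|_]; rewrite ?kJ ?andbT ?andbF.
Qed.

(** Fixed points and orbits of length 2 are still allowed, and nothing is asked outside [N]. *)
Definition S_perm (s : {perm T}) :=
  [forall v in N, (s v \in N) && S (pi v) (pi (s v))].

Lemma S_perm_exists : edge_cone S (\row_i (y i)%:R%R : 'rV[R]_q) -> exists s, S_perm s.
Proof.
move=> /(cone_flow symS)[A [fA sA rA]].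
have cA l : (\sum_k A k l = (y l)%:R)%R.
  by have := rA l; rewrite mxE => <-; apply: eq_bigr => k _; rewrite sA.
pose e v := [set w in N | S (pi v) (pi w)].
have hallN (B : {set T}) : B \subset N -> #|B| <= #|\bigcup_(b in B) e b|.
  (* [B] is no larger than the union of the classes it meets, and the flow carries the total of [y]
     on [J] into the columns of [nbhd S J]. *)
  move=> BN; pose J := [set pi v | v in B].
  have le1 : #|B| <= \sum_(k in J) y k.
    rewrite -card_classes; apply: subset_leq_card; apply/subsetP => v vB.
    by rewrite inE (subsetP BN) //=; apply: imset_f.
  apply: leq_trans le1 _.
  have -> : \bigcup_(b in B) e b = [set w in N | pi w \in nbhd S J].
    apply/setP => w; rewrite inE; apply/bigcupP/andP => [[b bB]|[wN]].
      rewrite inE => /andP[wN Sbw]; split=> //; rewrite inE; apply/existsP; exists (pi b).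
      by rewrite Sbw andbT; apply: imset_f.
    rewrite inE => /existsP[k /andP[/imsetP[b bB ->] Sbw]]; exists b => //.
    by rewrite inE wN.
  rewrite card_classes -(ler_nat R) !natr_sum.
  have -> : (\sum_(k in J) (y k)%:R = \sum_(k in J) \sum_l A k l :> R)%R.
    by apply: eq_bigr => k _; rewrite rA mxE.
  rewrite (sum_flow_nbhd J fA); apply: le_trans (sum_flow_subr _ _ fA) _.
  by rewrite (eq_bigr (fun l => (y l)%:R%R)).
have [f [f_inj fe]] := hall id hallN.
have g_inj : injective (fun v => if v \in N then f v else v).
  move=> u v; case: ifPn => uN; case: ifPn => vN; first exact: f_inj.
  - by move=> fuv; have := fe u uN; rewrite fuv inE (negPf vN).
  - by move=> fuv; have := fe v vN; rewrite -fuv inE (negPf uN).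
  by [].
exists (perm g_inj); apply/forall_inP => v vN; rewrite permE vN.
by have := fe v vN; rewrite inE.
Qed.

(* Exchanging the images of two nodes of the same class merges their orbits. *)
Lemma S_perm_min s0 : S_perm s0 -> exists s, S_perm s /\
  {in N &, forall v w, pi v = pi w -> w \in porbit s v}.
Proof.
move=> s0P; case: (@arg_minnP _ s0 S_perm (fun s => #|porbits s|) s0P) => s sP smin.
exists s; split=> // v w vN wN pvw; apply/negPn/negP => wv.
have tP : S_perm (tperm v w * s)%g.
  apply/forall_inP => u uN; rewrite permM.
  have sv := forall_inP sP _ vN; have sw := forall_inP sP _ wN.
  by case: tpermP => [->|->|_ _]; rewrite ?pvw // -?pvw //; exact: (forall_inP sP).
have := smin _ tP; have := porbits_mul_tperm s v w; rewrite /= porbit_sym wv.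
have -> : v != w by apply: contraNneq wv => ->; exact: porbit_id.
move=> /=; lia.
Qed.

End Cover.

Lemma bigcup_seqP (I : eqType) (T : finType) (r : seq I) (F : I -> {set T}) v :
  reflect (exists2 i, i \in r & v \in F i) (v \in \bigcup_(i <- r) F i).
Proof.
elim: r => [|i r IHr]; first by rewrite big_nil inE; right => -[].
rewrite big_cons inE; apply: (iffP orP) => [[vi|/IHr[j jr vj]]|[j]].
- by exists i; rewrite ?mem_head.
- by exists j; rewrite // inE jr orbT.
by rewrite inE => /orP[/eqP -> |jr vj]; [left | right; apply/IHr; exists j].
Qed.

Lemma next_neq (T : eqType) (c : seq T) v : uniq c -> 1 < size c -> v \in c -> next c v != v.
Proof.
move=> uc sc /rot_to[i c' E]; rewrite -(next_rot i uc) E.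
have : uniq (v :: c') by rewrite -E rot_uniq.
have : size (v :: c') = size c by rewrite -E size_rot.
case: c' {E} => [|w c'] /=; first by move=> E; rewrite -E in sc.
by rewrite eqxx inE => _ /andP[/norP[vw _] _]; rewrite eq_sym.
Qed.

Lemma perm_map_next (T : eqType) (c : seq T) : uniq c -> perm_eq (map (next c) c) c.
Proof.
move=> uc; apply: uniq_perm => //; first by rewrite map_inj_uniq //; exact: can_inj (prev_next uc).
move=> v; apply/mapP/idP => [[w wc ->]|vc]; first by rewrite mem_next.
by exists (prev c v); rewrite ?mem_prev // next_prev.
Qed.

(** * The cycle cover formed by the orbits *)

Section OrbitCover.
Variables (q : nat) (S : rel 'I_q) (y : 'I_q -> nat).
Variables (T : finType) (pi : T -> 'I_q) (G : sgraph T).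
Hypothesis KG : complete_partite S y pi G.
Hypothesis yS : forall i j, S i j -> 3 <= y i \/ 3 <= y j.
Variable s : {perm T}.
Hypothesis sP : S_perm S pi (nodes G) s.
Hypothesis smin : {in nodes G &, forall v w, pi v = pi w -> w \in porbit s v}.

Let reps := [set v in nodes G | froot s v == v].
Let cs := [seq orbit s v | v <- enum reps].

Let s_sym : fconnect s =2 (fun v w => fconnect s w v) := fconnect_sym (@perm_inj T s).

Let fconnect_nodes v w : fconnect s v w -> v \in nodes G -> w \in nodes G.
Proof.
move=> /iter_findex <- vG; elim: (findex _ _ _) => //= n IHn.
by have /andP[] := forall_inP sP _ IHn.
Qed.

Let fconnect_class v w : v \in nodes G -> w \in nodes G -> pi v = pi w -> fconnect s v w.
Proof.
move=> vG wG /(smin vG wG)/porbitP[n ->]; rewrite permX; exact: fconnect_iter.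
Qed.

(** The orbit contains the whole classes of [v] and of [s v], and one of the two has at least 3
    nodes. *)
Let size_orbit_ge3 v : v \in nodes G -> 3 <= size (orbit s v).
Proof.
move=> vG; have /andP[svG Sv] := forall_inP sP _ vG.
have big u : u \in nodes G -> fconnect s v u -> 3 <= y (pi u) -> 3 <= size (orbit s v).
  move=> uG vu yu; apply: leq_trans yu _; rewrite -KG.1 -(card_uniqP (orbit_uniq s v)).
  apply: subset_leq_card; apply/subsetP => w; rewrite inE => /andP[wG /eqP pw].
  by rewrite -fconnect_orbit; apply: connect_trans vu (fconnect_class _ _ _).
have [/big|/big] := yS Sv; apply=> //; exact: fconnect1.
Qed.

Let next_orbit v u : u \in orbit s v -> next (orbit s v) u = s u.
Proof. by move=> uv; rewrite (nextE (cycle_orbit (@perm_inj T s) v)). Qed.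

Let cycle_edge v w : v \in reps -> w \in orbit s v ->
  [/\ w \in nodes G, s w \in nodes G, w != s w & [set w; s w] \in edges G].
Proof.
rewrite inE => /andP[vG _] wv; have wG : w \in nodes G.
  by apply: fconnect_nodes vG; rewrite fconnect_orbit.
have /andP[swG Sw] := forall_inP sP _ wG.
have ws : w != s w.
  by rewrite eq_sym -(next_orbit wv) next_neq ?orbit_uniq // ltnW ?size_orbit_ge3.
by split=> //; rewrite KG.2.
Qed.

Let cover_edges := \bigcup_(c <- cs) cycle_edges c.

Let cover_edgesE e : e \in cover_edges ->
  exists v w, [/\ v \in reps, w \in orbit s v & e = [set w; s w]].
Proof.
move=> /bigcup_seqP[c /mapP[v vr ->] /imsetP[w wv ->]].
by exists v, w; rewrite -mem_enum vr next_orbit.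
Qed.

Lemma orbit_cover : exists H, cycle_cover G H /\ at_most_cycles q H.
Proof.
have HP : [forall e in cover_edges, (e \subset nodes G) && (#|e| == 2)].
  apply/forall_inP => e /cover_edgesE[v [w [vr wv ->]]].
  have [wG swG ws _] := cycle_edge vr wv.
  by rewrite subUset !sub1set wG swG cards2 ws.
have HU : disjoint_cycle_union cs (SGraph HP).
  split=> //=.
  - apply/allP => c /mapP[v]; rewrite mem_enum inE => /andP[vG _] ->.
    by rewrite orbit_uniq size_orbit_ge3.
  - rewrite pairwise_map; have := enum_uniq (mem reps); rewrite uniq_pairwise.
    apply: (@sub_in_pairwise _ (mem reps)); last by apply/allP => v; rewrite mem_enum.
    move=> v w /=; rewrite !inE => /andP[_ /eqP rv] /andP[_ /eqP rw] vw.
    apply: contraNT vw => /pred0Pn[u /= /andP[]]; rewrite -!fconnect_orbit.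
    by move=> /(fingraph.rootP s_sym) vu /(fingraph.rootP s_sym) wu; rewrite -rv -rw vu wu.
  apply/setP => v; apply/idP/bigcup_seqP => [vG|[c /mapP[u]]].
    have rv : fconnect s v (froot s v) by exact: connect_root.
    exists (orbit s (froot s v)); last by rewrite inE -fconnect_orbit s_sym rv.
    apply: map_f; rewrite mem_enum inE (fconnect_nodes rv vG) /=.
    by rewrite (fingraph.root_root s_sym).
  rewrite mem_enum inE => /andP[uG _] ->; rewrite inE -fconnect_orbit => uv.
  exact: fconnect_nodes uv uG.
exists (SGraph HP); split; last first.
  exists cs; split=> //; rewrite size_map -cardE -[q in _ <= q]card_ord.
  (* Nodes of one class share an orbit, so [pi] is injective on orbit roots and there are at most q
     of them. *)
  apply: (@leq_card_in _ _ pi) => v w; rewrite !inE => /andP[vG /eqP rv] /andP[wG /eqP rw] pvw.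
  by have /(fingraph.rootP s_sym) := fconnect_class vG wG pvw; rewrite rv rw.
split=> //; last by exists cs.
rewrite /subgraph /= subxx /=; apply/subsetP => e /cover_edgesE[v [w [vr wv ->]]].
by have [] := cycle_edge vr wv.
Qed.

End OrbitCover.

Lemma uniq_flatten_disjoint (T : finType) (cs : seq (seq T)) :
  all uniq cs -> pairwise (fun c d : seq T => [disjoint c & d]) cs -> uniq (flatten cs).
Proof.
elim: cs => //= c cs IHcs /andP[uc /IHcs ucs] /andP[/allP dc /ucs u].
rewrite cat_uniq uc u andbT /=; apply/hasPn => v /flattenP[d /dc cd vd].
by apply/negP => /= vc; have := disjointFr cd vc; rewrite vd.
Qed.

(** * Two-regular subgraphs as feasible points of (LP) *)

Section UpperBound.
Variables (R : realType) (q : nat) (S : rel 'I_q) (x : 'I_q -> nat).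
Variables (T : finType) (pi : T -> 'I_q) (G H : sgraph T).
Hypothesis symS : symmetric S.
Hypothesis KG : complete_partite S x pi G.

(** Orient every cycle along [next]: the numbers of arcs between classes form a flow whose row and
    column sums both count nodes, since [next] permutes each cycle. *)
Lemma two_regular_LP_feasible : subgraph H G -> two_regular H ->
  LP_feasible S x (\row_i #|[set v in nodes H | pi v == i]|%:R%R : 'rV[R]_q).
Proof.
move=> /andP[HGn HGe] [cs [/allP csP csD nH eH]].
have csU c : c \in cs -> uniq c by move=> /csP/andP[].
pose z k := \sum_(c <- cs) \sum_(v <- c) (pi v == k).
have zE k : #|[set v in nodes H | pi v == k]| = z k.
  have uF : uniq (flatten cs) by apply: uniq_flatten_disjoint => //; apply/allP.
  rewrite /z -big_flatten /= big_uniq //= -sum1_card big_mkcond [RHS]big_mkcond /=.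
  apply: eq_bigr => v _; rewrite inE nH.
  have -> : (v \in \bigcup_(c <- cs) cycle_nodes c) = (v \in flatten cs).
    apply/bigcup_seqP/flattenP => [[c cc]|[c cc vc]]; last by exists c; rewrite ?inE ?vc.
    by rewrite inE => vc; exists c.
  by case: (v \in _) => //=; case: (pi v == k).
pose A k l := \sum_(c <- cs) \sum_(v <- c) ((pi v == k) && (pi (next c v) == l)).
have rA k : \sum_l A k l = z k.
  rewrite exchange_big; apply: eq_bigr => c _; rewrite exchange_big; apply: eq_bigr => v _.
  by rewrite (bigD1 (pi (next c v))) //= eqxx andbT big1 ?addn0 // => l; rewrite eq_sym => /negPf ->; rewrite andbF.
have cA l : \sum_k A k l = z l.
  rewrite exchange_big /z !big_seq; apply: eq_bigr => c cc.
  rewrite exchange_big -[RHS](perm_big _ (perm_map_next (csU c cc))) big_map; apply: eq_bigr => v _.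
  by rewrite (bigD1 (pi v)) //= eqxx big1 ?addn0 // => k; rewrite eq_sym => /negPf ->.
split; last first.
  move=> i; rewrite mxE ler_nat -KG.1; apply: subset_leq_card; apply/subsetP => v.
  by rewrite !inE => /andP[/(subsetP HGn) -> ->].
apply: (@flow_cone R q S symS (fun k l => (A k l)%:R%R)).
- split=> k l; first exact: ler0n.
  move=> Skl; rewrite /A big_seq big1 // => c cc; rewrite big_seq big1 // => v vc.
  case: eqP => //= pv; case: eqP => //= pn; case/negP: Skl; rewrite -pv -pn.
  have /andP[uc c3] := csP c cc.
  have inH u : u \in c -> u \in nodes G.
    move=> uc'; apply: (subsetP HGn); rewrite nH; apply/bigcup_seqP; exists c => //.
    by rewrite inE uc'.
  rewrite -KG.2 ?inH ?mem_next //; last by rewrite eq_sym next_neq // ltnW.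
  apply: (subsetP HGe); rewrite eH; apply/bigcup_seqP; exists c => //.
  by apply/imsetP; exists v.
- by move=> k; rewrite -natr_sum rA mxE zE.
- by move=> l; rewrite -natr_sum cA mxE zE.
Qed.

End UpperBound.

Local Open Scope ring_scope.

Theorem theorem1 (R : realType) :
  (* item 1 *)
  (forall (q : nat) (S : rel 'I_q) (x : 'I_q -> nat),
     symmetric S -> (forall i, (1 <= x i)%N) ->
     forall y : 'rV[R]_q, LP_extremal_solution S x y ->
     forall i, y 0 i \is a Num.int) /\
  (* item 2 *)
  (exists (P : cmd) (C : nat),
     forall (q : nat) (S : rel 'I_q) (x : 'I_q -> nat),
     (1 <= q)%N -> symmetric S -> (forall i, (1 <= x i)%N) ->
     forall s : state, input_state S x s ->
     exists (t : nat) (s' : state),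
       [/\ exec P s t s', (t <= C * q ^ 3)%N
         & LP_solution S x (\row_i (output s' i)%:~R : 'rV[R]_q)]) /\
  (* item 3 *)
  (forall (q : nat) (S : rel 'I_q) (x : 'I_q -> nat),
     symmetric S -> (forall i, (3 <= x i)%N) ->
     forall y : 'I_q -> nat, LP_solution S x (\row_i (y i)%:R : 'rV[R]_q) ->
     forall (T : finType) (pi : T -> 'I_q) (Kx Ky : sgraph T),
     complete_partite S x pi Kx -> complete_partite S y pi Ky ->
     subgraph Ky Kx ->
     (exists H : sgraph T, cycle_cover Ky H /\ at_most_cycles q H) /\
     (forall H : sgraph T, cycle_cover Ky H -> at_most_cycles q H ->
        optimal (fun H' : sgraph T => subgraph H' Kx /\ two_regular H')
                (fun H' : sgraph T => #|nodes H'|) H)).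
Proof.
split; [|split].
- by move=> q S x symS _ y; exact: LP_extremal_integral.
- exists program, ((expr_cost loop_test + cmd_cost body_cmd).+1 * 101)%N.
  by move=> q S x q0 symS _ s; exact: program_correct.
move=> q S x symS x3 y yopt T pi Kx Ky KKx KKy sub.
split=> [|H [HK H2 HKy] _].
  have [s0 s0P] := S_perm_exists symS KKy.1 yopt.1.1.
  have [s [sP smin]] := S_perm_min s0P.
  (* Each edge of [S] has an end where [y] equals [x], and there [x3] supplies the three nodes. *)
  apply: (orbit_cover KKy _ sP smin) => i j Sij.
  have [lt|le] := ltnP (y i) (x i); last by left; apply: leq_trans (x3 i) le.
  have := LP_no_slack_edge symS yopt Sij; rewrite !mxE ltr_nat lt => /(_ isT)/eqP.
  by rewrite eqr_nat => /eqP ->; right.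
have sum_classes (N : {set T}) : (\sum_i #|[set v in N | pi v == i]|)%N = #|N|.
  rewrite -sum1_card (partition_big pi predT) //=; apply: eq_bigr => i _.
  by rewrite -sum1_card; apply: eq_bigl => v; rewrite inE.
have sum_rows (z : 'I_q -> nat) : \sum_i (\row_i (z i)%:R : 'rV[R]_q) 0 i = (\sum_i z i)%:R.
  by rewrite natr_sum; apply: eq_bigr => i _; rewrite mxE.
split=> [|H' [H'Kx H'2]].
  split=> //; move: HK sub => /andP[Hn He] /andP[Kn Ke].
  by rewrite /subgraph (subset_trans Hn Kn) (subset_trans He Ke).
(* The class sizes of [H'] are feasible, and the number of nodes of [H] is the optimal value. *)
have := yopt.2 _ (two_regular_LP_feasible R symS KKx H'Kx H'2).
by rewrite !sum_rows ler_nat HKy -!sum_classes [X in (_ <= X)%O](eq_bigr _ (fun i _ => KKy.1 i)).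
Qed.
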